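(* For real $x$, $\nu$, and positive $a$, $$\frac{\partial}{\partial\nu}\left\{(2a)^{\nu/2}\, c^{a}_{\lceil a-x\sqrt{2a}\rceil}(\nu)\right\} = \frac{\partial}{\partial\nu}H_\nu(x) + O\left(\frac{1}{\sqrt a}\right),$$ where $c_n^a(\nu)$ are Charlier polynomials and $H_\nu(x)$ is the Hermite function. The error bound $O(1/\sqrt a)$ is uniform for $\nu$ and $x$ in any bounded interval, and is sharp (in the sense that there are $\nu$ and $x$ such that the error is proportional to $1/\sqrt a$ for arbitrarily large $a$).
   Context: For $a>0$ and integer $n\ge 0$, the Charlier polynomial is $c_n^a(x):=\sum_{k=0}^{n}\binom{n}{k}\binom{x}{k}k!\,(-a)^{-k}$, where $\binom{x}{k}:=x(x-1)\cdots(x-k+1)/k!$ for $k\ge1$ and $\binom{x}{0}:=1$ (real $x$). $\lceil x\rceil$ is the smallest integer not smaller than $x$. The $O(1/\sqrt a)$ refers to $a\to\infty$, with $a$ large enough that $\lceil a-x\sqrt{2a}\rceil\ge 0$. For real $\nu,x$ the Hermite function is $$H_\nu(x):=2^\nu\sqrt\pi\left[\frac{1}{\Gamma\left(\frac{1-\nu}{2}\right)}M\left(-\frac{\nu}{2};\frac12;x^2\right)-\frac{2x}{\Gamma\left(-\frac{\nu}{2}\right)}M\left(\frac{1-\nu}{2};\frac32;x^2\right)\right],$$ where $M$ is the confluent hypergeometric function of the first kind, and expressions involving the gamma function at a non-positive integer are interpreted by their limiting values (so $1/\Gamma$ is $0$ there). *)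

(* Defs.v *)
From mathcomp Require Import all_boot all_order all_algebra.
From mathcomp Require Import all_classical all_reals all_analysis.

Set Implicit Arguments.
Unset Strict Implicit.
Unset Printing Implicit Defensive.

Import Order.TTheory GRing.Theory Num.Theory.
Import numFieldNormedType.Exports.
Local Open Scope classical_set_scope.
Local Open Scope ring_scope.

Definition gbinom (R : realType) (x : R) (k : nat) : R :=
  (\prod_(i < k) (x - i%:R)) / k`!%:R.

Definition charlier (R : realType) (a : R) (n : nat) (x : R) : R :=
  \sum_(k < n.+1) 'C(n, k)%:R * gbinom x k * k`!%:R * (- a) ^- k.

Definition pochhammer (R : realType) (a : R) (k : nat) : R :=
  \prod_(i < k) (a + i%:R).

(* Kummer's function M(a; b; z), for b not a non-positive integer. *)
Definition kummerM (R : realType) (a b z : R) : R :=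
  limn (series (fun k : nat =>
    pochhammer a k / pochhammer b k * (z ^+ k / k`!%:R))).

(* Euler's integral; it converges exactly for 0 < z. *)
Definition euler_integral (R : realType) (z : R) : R :=
  (\int[lebesgue_measure]_(t in `]0, +oo[) (t `^ (z - 1) * expR (- t)))%R.

Definition gamma_shift (R : realType) (z : R) : nat :=
  if 0 < z then 0%N else (Num.truncn (- z)).+1.

(* Gamma(z) = Gamma(z + m) / (z (z + 1) ... (z + m - 1)), where m is the least
   natural number with 0 < z + m.  At a pole z = 0, -1, -2, ... the product
   contains the factor 0, so that Gamma z = 0 because 0^-1 = 0, and hence
   (Gamma z)^-1 = 0: this is the limiting value of 1/Gamma at the pole. *)
Definition Gamma (R : realType) (z : R) : R :=
  euler_integral (z + (gamma_shift z)%:R) / pochhammer z (gamma_shift z).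

Definition hermite (R : realType) (nu x : R) : R :=
  2 `^ nu * Num.sqrt pi *
    ((Gamma ((1 - nu) / 2))^-1 * kummerM (- (nu / 2)) (1 / 2) (x ^+ 2)
     - 2 * x / Gamma (- (nu / 2)) * kummerM ((1 - nu) / 2) (3 / 2) (x ^+ 2)).

Definition charlier_degree (R : realType) (a x : R) : int :=
  Num.ceil (a - x * Num.sqrt (2 * a)).

(* The absolute value only casts the degree from int to nat; it is meaningful
   when [0 <= charlier_degree a x]. *)
Definition scaled_charlier (R : realType) (a x nu : R) : R :=
  (2 * a) `^ (nu / 2) * charlier a `|charlier_degree a x|%N nu.

(* Main.v *)
Require Import Defs.
From mathcomp Require Import all_boot all_order all_algebra.
From mathcomp Require Import all_classical all_reals all_analysis.
From mathcomp Require Import measurable_realfun ring lra.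

(* Write [f] for [scaled_charlier a x] and [H] for [hermite ^~ x].  For [nu < 0],
   [Gamma (- nu) f nu] is the integral over [s > 0] of
   [s ^ (- nu - 1) exp (- c s) (1 + d s) ^ n] with [c = sqrt (2 a)] and
   [d = sqrt (2 / a)], while [Gamma (- nu) H nu] is the integral of
   [s ^ (- nu - 1) exp (- s ^ 2 - 2 x s)].  For [nu <= -2] a pointwise comparison
   of the kernels shows that [f - H] is [O(d)] and Lipschitz in [nu] with constant
   [O(d)].  The three-term recurrences
     [f (nu + 1) = d (nu + a - n) f nu - 2 nu f (nu - 1)],
     [H (nu + 1) = 2 x H nu - 2 nu H (nu - 1)]
   carry this to every bounded interval of [nu].  The Lipschitz bound makes the
   difference quotients of [H] Cauchy, because those of [f] converge, and it bounds
   [f' - H']; nothing is differentiated under an integral sign.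

   For the sharpness take [x = 0], [a = n] an integer and [nu = 1], where the
   recurrences give [f' 1 - H' 1 = d - 2 (f (- 1) - H (- 1))] and reduce [f (- 1)]
   to [f (- 2)] and [f (- 3)]; the second-order expansion of the kernel yields the
   limit [sqrt 2 / 3] of [sqrt a (f' 1 - H' 1)]. *)

Set Implicit Arguments.
Unset Strict Implicit.
Unset Printing Implicit Defensive.

Import Order.TTheory GRing.Theory Num.Theory.
Import numFieldNormedType.Exports.
Local Open Scope classical_set_scope.
Local Open Scope ring_scope.

(** * Integrals over the open half-line *)

(** A uniform bound on [f - H] alone says nothing about derivatives, so size and Lipschitz constant
    in [nu] are carried together. The base range [nu <= - 2] makes the exponent [p = - nu - 1] at
    least 1: then [s ^ p ln s] stays bounded near 0, which gives the Lipschitz dependence on [nu],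
    and [Gamma (- nu)] is at least 1, so that dividing by it is harmless. The recurrences are used
    upwards only, each value being obtained from two smaller indices without any division.

    [hermite] is defined by Kummer series with Gamma factors. Matching it with its integral takes
    Legendre's duplication formula, hence the log-convexity argument for Gamma; extending it to all
    real [nu] takes contiguous relations and the functional equation of [1 / Gamma], which holds at
    the poles too.

    The degree is [n = a - c x + th] with [0 <= th <= 1]. Since [c d = 2], this gives
    [d (a - n) = 2 x - d th], so the coefficients of the two recurrences differ by [O(d)], and
    [d = sqrt 2 / sqrt a] is the rate of the theorem. *)

Lemma continuous_measurable_0y (R : realType) (f : R -> R) :
  (forall t : R, 0 < t -> {for t, continuous f}) ->
  measurable_fun (`]0, +oo[%classic : set R) f.
Proof.
move=> cf; apply: open_continuous_measurable_fun; first exact: interval_open.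
by move=> t; rewrite inE/= in_itv/= andbT; exact: cf.
Qed.

(** Monotone convergence for a nonnegative integrand. The endpoints are general monotone sequences
    because the substitution rule exhausts one side along [[1/n, n]] and the other along the image
    of this interval. *)
Lemma cvg_integral_exhaust_0y (R : realType) (f : R -> R) (u v : nat -> R) :
  (forall t : R, 0 < t -> {for t, continuous f}) ->
  (forall t : R, 0 < t -> 0 <= f t) ->
  {homo u : m n / (m <= n)%N >-> n <= m} -> (forall n, 0 < u n) ->
  u @ \oo --> 0 ->
  {homo v : m n / (m <= n)%N >-> m <= n} -> v @ \oo --> +oo ->
  (\int[lebesgue_measure]_(t in `[u n, v n]) (f t)%:E)%E @[n --> \oo] -->
  (\int[lebesgue_measure]_(t in `]0%R, +oo[) (f t)%:E)%E.
Proof.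
move=> cf f0 uh u0 uc vh vc.
have -> : (`]0, +oo[%classic : set R) = \bigcup_n `[u n, v n]%classic.
  apply/seteqP; split=> t /=; last first.
    case=> n _ /=; rewrite !in_itv/= andbT => /andP[ut _].
    exact: lt_le_trans (u0 n) ut.
  rewrite in_itv/= andbT => t0.
  have : \forall n \near \oo, u n <= t /\ t <= v n.
    near=> n; split.
      near: n; apply: (cvgr_le _ uc); exact: t0.
    near: n; move/cvgryPge: vc; exact.
  case=> N _ /(_ N (leqnn _))[? ?].
  by exists N => //=; rewrite in_itv/=; apply/andP.
apply: ge0_nondecreasing_set_cvg_integral => //.
- move=> m n mn; rewrite subsetEset => t /=; rewrite !in_itv/= => /andP[a b].
  by rewrite (le_trans (uh _ _ mn))//= (le_trans b)// vh.
- move=> n; apply/measurable_EFinP.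
  apply: measurable_funS (continuous_measurable_0y cf) => //.
  by move=> t /=; rewrite !in_itv/= andbT => /andP[+ _]; apply: lt_le_trans.
- move=> n t /=; rewrite in_itv/= => /andP[ut _].
  by rewrite lee_fin f0// (lt_le_trans _ ut).
Unshelve. all: by end_near. Qed.

Lemma harmonic_exhaust (R : realType) :
  [/\ {homo (fun n => n.+1%:R^-1 : R) : m n / (m <= n)%N >-> n <= m},
      (fun n => n.+1%:R^-1 : R) @ \oo --> 0,
      {homo (fun n => n.+1%:R : R) : m n / (m <= n)%N >-> m <= n} &
      (fun n => n.+1%:R : R) @ \oo --> +oo].
Proof.
split.
- by move=> m n mn; rewrite lef_pV2 ?posrE// ler_nat.
- exact: cvg_harmonic.
- by move=> m n mn; rewrite ler_nat.
- by have := @cvgr_idn R; rewrite -(cvg_shiftS (fun n => n%:R : R)).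
Qed.

(** The FTC and substitution rules are phrased with [derive1]; its continuity has to be transferred
    from [f], with which it is known to agree on the open half-line only. *)
Lemma derive1_0y (R : realType) (F f : R -> R) :
  (forall t : R, 0 < t -> is_derive t 1 F (f t)) ->
  (forall t : R, 0 < t -> {for t, continuous f}) ->
  (forall t : R, 0 < t -> derive1 F t = f t) /\
  (forall t : R, 0 < t -> {for t, continuous (derive1 F)}).
Proof.
move=> dF cf.
have E t : 0 < t -> derive1 F t = f t.
  by move=> t0; rewrite derive1E; apply: derive_val; exact: dF.
split => // t t0; rewrite /prop_for /continuous_at E//.
apply: cvg_trans (cf _ t0); apply: near_eq_cvg; near=> s.
rewrite E//; near: s; exact: lt_nbhsr.
Unshelve. all: by end_near. Qed.

Lemma derivable_continuous_0y (R : realType) (F f : R -> R) :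
  (forall t : R, 0 < t -> is_derive t 1 F (f t)) ->
  forall t : R, 0 < t -> {for t, continuous F}.
Proof.
move=> dF t t0; apply: differentiable_continuous; apply/derivable1_diffP.
by have [] := dF _ t0.
Qed.

Lemma continuous_within_0y (R : realType) (f : R -> R) (a b : R) : 0 < a ->
  (forall t : R, 0 < t -> {for t, continuous f}) ->
  {within `[a, b], continuous f}.
Proof.
move=> a0 cf; apply: continuous_in_subspaceT => t.
by rewrite inE/= in_itv/= => /andP[at_ _]; apply/cf/(lt_le_trans a0).
Qed.

Lemma derivable_oo_LR_0y (R : realType) (F f : R -> R) (a b : R) : 0 < a -> a <= b ->
  (forall t : R, 0 < t -> is_derive t 1 F (f t)) ->
  derivable_oo_LRcontinuous F a b.
Proof.
move=> a0 ab dF; have cF := derivable_continuous_0y dF.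
split.
- move=> t; rewrite in_itv/= => /andP[at_ _].
  by have [] := dF _ (lt_trans a0 at_).
- by apply: cvg_at_right_filter; exact: cF.
- by apply: cvg_at_left_filter; apply: cF; exact: lt_le_trans a0 ab.
Qed.

Lemma integral_FTC_0y (R : realType) (F f : R -> R) (l0 l : R) :
  (forall t : R, 0 < t -> is_derive t 1 F (f t)) ->
  (forall t : R, 0 < t -> {for t, continuous f}) ->
  (forall t : R, 0 < t -> 0 <= f t) ->
  F t @[t --> 0^'+] --> l0 -> F t @[t --> +oo] --> l ->
  (\int[lebesgue_measure]_(t in `]0%R, +oo[) (f t)%:E = (l - l0)%:E)%E.
Proof.
move=> dF cf f0 F0 Fy; have [uh uc vh vc] := harmonic_exhaust R.
have [dE _] := derive1_0y dF cf.
have := cvg_integral_exhaust_0y cf f0 uh _ uc vh vc.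
move=> /(_ (fun n => ltac:(by rewrite invr_gt0))) h.
have hE : {near \oo, (fun n => (F n.+1%:R - F n.+1%:R^-1)%:E) =1 (fun n =>
    (\int[lebesgue_measure]_(t in `[n.+1%:R^-1%R, n.+1%:R%R]) (f t)%:E)%E)}.
  near=> n => /=; rewrite EFinB; apply/esym/continuous_FTC2.
  (* At [n = 0] the interval shrinks to the point 1, whereas [continuous_FTC2] asks for distinct
     endpoints. *)
  - have n0 : (0 < n)%N by near: n; exists 1%N.
    by rewrite (@lt_trans _ _ 1)// ?invf_lt1// ltr1n ltnS.
  - exact: continuous_within_0y.
  - apply: derivable_oo_LR_0y dF => //.
    by rewrite (@le_trans _ _ 1)// ?invf_le1// ler1n.
  - move=> t; rewrite in_itv/= => /andP[nt _].
    by rewrite dE// (lt_trans _ nt)// invr_gt0.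
apply: (cvg_unique _ h) => //; apply: (cvg_trans (near_eq_cvg hE)).
apply: cvg_EFin; first exact: nearW.
apply: cvgB; first exact: (cvg_comp _ _ vc Fy).
by move/cvg_at_rightP: F0; apply; split => // n; rewrite invr_gt0.
Unshelve. all: by end_near. Qed.

Lemma increasing_0y_gt0 (R : realType) (F : R -> R) (t : R) :
  (forall s t : R, 0 < s -> s < t -> F s < F t) ->
  F t @[t --> 0^'+] --> 0 -> 0 < t -> 0 < F t.
Proof.
move=> iF F0 t0; have t20 : 0 < t / 2 by rewrite divr_gt0.
apply: (@le_lt_trans _ _ (F (t / 2))); last first.
  by apply: iF => //; rewrite gtr_pMr// invf_lt1// ltr1n.
rewrite -(cvg_lim _ F0)//; apply: (limr_le (cvgP _ F0)); near=> s.
by apply/ltW/iF.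
Unshelve. all: by end_near. Qed.

Lemma integral_subst_0y (R : realType) (F f G : R -> R) :
  (forall t : R, 0 < t -> is_derive t 1 F (f t)) ->
  (forall t : R, 0 < t -> {for t, continuous f}) ->
  (forall t : R, 0 < t -> 0 <= f t) ->
  (forall s t : R, 0 < s -> s < t -> F s < F t) ->
  F t @[t --> 0^'+] --> 0 -> F t @[t --> +oo] --> +oo ->
  (forall t : R, 0 < t -> {for t, continuous G}) ->
  (forall t : R, 0 < t -> 0 <= G t) ->
  (\int[lebesgue_measure]_(t in `]0%R, +oo[) (G t)%:E =
   \int[lebesgue_measure]_(t in `]0%R, +oo[) (G (F t) * f t)%:E)%E.
Proof.
move=> dF cf f0 iF F0 Fy cG G0; have [uh uc vh vc] := harmonic_exhaust R.
have [dE cF'] := derive1_0y dF cf.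
have cF := derivable_continuous_0y dF.
have u0 n : 0 < n.+1%:R^-1 :> R by rewrite invr_gt0.
have mF s t : 0 < s -> s <= t -> F s <= F t.
  by move=> s0; rewrite le_eqVlt => /predU1P[->//|/(iF _ _ s0)/ltW].
have Fu : F n.+1%:R^-1 @[n --> \oo] --> 0.
  by move/cvg_at_rightP: F0; apply; split.
have Fv : F n.+1%:R @[n --> \oo] --> +oo by exact: (cvg_comp _ _ vc Fy).
have Fpos t : 0 < t -> 0 < F t by move=> t0; exact: (increasing_0y_gt0 iF F0).
have h1 := cvg_integral_exhaust_0y cG G0 (fun m n mn => mF _ _ (u0 n) (uh _ _ mn))
  (fun n => Fpos _ (u0 n)) Fu (fun m n mn => mF _ _ (ltr0Sn _ _) (vh _ _ mn)) Fv.
have cGF t : 0 < t -> {for t, continuous (fun t => G (F t) * f t)}.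
  move=> t0; apply: cvgM; last exact: cf.
  by apply: continuous_comp; [exact: cF|apply: cG; exact: Fpos].
have GF0 t : 0 < t -> 0 <= G (F t) * f t.
  by move=> t0; rewrite mulr_ge0 ?f0// G0// Fpos.
have h2 := cvg_integral_exhaust_0y cGF GF0 uh u0 uc vh vc.
have hE : (fun n => (\int[lebesgue_measure]_(t in
    `[F n.+1%:R^-1%R, F n.+1%:R%R]) (G t)%:E)%E) =
  (fun n => (\int[lebesgue_measure]_(t in
    `[n.+1%:R^-1%R, n.+1%:R%R]) (G (F t) * f t)%:E)%E); last first.
  by rewrite hE in h1; exact: (cvg_unique _ h1 h2).
apply/funext => n.
have uv : n.+1%:R^-1 <= n.+1%:R :> R.
  by rewrite (@le_trans _ _ 1)// ?invf_le1// ler1n.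
have vpos : 0 < n.+1%:R :> R by [].
rewrite (integration_by_substitution_increasing uv).
- apply: eq_integral => t; rewrite inE/= in_itv/= => /andP[nt _] /=.
  by rewrite fctE /= dE// (lt_le_trans _ nt).
- move=> s t; rewrite !in_itv/= => /andP[ns _] _ st.
  by apply: iF => //; exact: lt_le_trans ns.
- move=> t; rewrite in_itv/= => /andP[nt _].
  by apply: cF'; exact: lt_trans nt.
- apply/cvg_ex; exists (derive1 F n.+1%:R^-1).
  by apply: cvg_at_right_filter; exact: cF'.
- apply/cvg_ex; exists (derive1 F n.+1%:R).
  by apply: cvg_at_left_filter; exact: cF'.
- exact: derivable_oo_LR_0y dF.
- by apply: continuous_within_0y; rewrite ?Fpos.
Unshelve. all: by end_near. Qed.

Local Notation Rint0y f := (Rintegral lebesgue_measure `]0%R, +oo[%classic f).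
Local Notation integrable0y f :=
  (lebesgue_measure.-integrable `]0%R, +oo[%classic (EFin \o f)).

Lemma Rint0y_eq (R : realType) (f g : R -> R) :
  (forall t : R, 0 < t -> f t = g t) -> Rint0y f = Rint0y g.
Proof.
move=> fg; apply: eq_Rintegral => t; rewrite inE/= in_itv/= andbT; exact: fg.
Qed.

Lemma integrable0y_eq (R : realType) (f g : R -> R) :
  (forall t : R, 0 < t -> f t = g t) -> integrable0y f -> integrable0y g.
Proof.
move=> fg; apply: eq_integrable => // t.
by rewrite inE/= in_itv/= andbT => /fg /= ->.
Qed.

Lemma Rint0yD (R : realType) (f g : R -> R) :
  integrable0y f -> integrable0y g ->
  integrable0y (fun t => f t + g t) /\
  Rint0y (fun t => f t + g t) = Rint0y f + Rint0y g.
Proof.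
move=> fi gi; split; last by rewrite RintegralD.
by have := integrableD _ fi gi; apply.
Qed.

Lemma Rint0yZ (R : realType) (c : R) (f : R -> R) :
  integrable0y f ->
  integrable0y (fun t => c * f t) /\ Rint0y (fun t => c * f t) = c * Rint0y f.
Proof.
move=> fi; split; last by rewrite RintegralZl.
by have := integrableZl _ c fi; apply.
Qed.

Lemma Rint0yB (R : realType) (f g : R -> R) :
  integrable0y f -> integrable0y g ->
  integrable0y (fun t => f t - g t) /\
  Rint0y (fun t => f t - g t) = Rint0y f - Rint0y g.
Proof.
move=> fi gi; split; last by rewrite RintegralB.
by have := integrableB _ fi gi; apply.
Qed.

Lemma Rint0y_sum (R : realType) (n : nat) (f : nat -> R -> R) :
  (forall k, integrable0y (f k)) ->
  integrable0y (fun t => \sum_(k < n) f k t) /\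
  Rint0y (fun t => \sum_(k < n) f k t) = \sum_(k < n) Rint0y (f k).
Proof.
move=> fi; elim: n => [|n [IHi IHv]].
  split; last first.
    by rewrite (@Rint0y_eq _ _ (cst 0)) ?Rintegral_cst ?mul0r ?big_ord0// => t _;
       rewrite big_ord0.
  apply: (@integrable0y_eq _ (cst 0)) => [t _|]; first by rewrite big_ord0.
  by apply: eq_integrable (integrable0 _ _).
have [i v] := Rint0yD IHi (fi n).
split.
  by apply: integrable0y_eq i => t _; rewrite big_ord_recr.
by rewrite big_ord_recr/= -IHv -v; apply: Rint0y_eq => t _; rewrite big_ord_recr.
Qed.

Lemma le_Rint0y (R : realType) (f g : R -> R) :
  integrable0y f -> integrable0y g -> (forall t : R, 0 < t -> f t <= g t) ->
  Rint0y f <= Rint0y g.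
Proof.
move=> fi gi fg; apply: le_Rintegral => // t /=; rewrite in_itv/= andbT; exact: fg.
Qed.

Lemma integrable0y_ge0 (R : realType) (f : R -> R) (l : R) :
  (forall t : R, 0 < t -> {for t, continuous f}) ->
  (forall t : R, 0 < t -> 0 <= f t) ->
  (\int[lebesgue_measure]_(t in `]0%R, +oo[) (f t)%:E = l%:E)%E ->
  integrable0y f /\ Rint0y f = l.
Proof.
move=> cf f0 fl; split; last by rewrite /Rintegral fl.
apply/integrableP; split.
  by apply/measurable_EFinP; exact: continuous_measurable_0y.
rewrite [X in (X < _)%E](_ : _ = l%:E) ?ltry// -fl; apply: eq_integral => t.
by rewrite inE/= in_itv/= andbT => t0; rewrite /= ger0_norm// f0.
Qed.

Lemma continuous_expRM (R : realType) (c : R) : continuous (fun t => expR (c * t)).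
Proof.
move=> t; apply: continuous_comp; last exact: continuous_expR.
exact: mulrl_continuous.
Qed.

Lemma continuous_expRN (R : realType) (C c : R) :
  continuous (fun t => C * expR (- (c * t))).
Proof.
have -> : (fun t => C * expR (- (c * t))) = (fun t => C * expR (- c * t)).
  by apply/funext => t; rewrite mulNr.
move=> t; exact: (cvgM (cvg_cst _) (@continuous_expRM _ (- c) t)).
Qed.

Lemma cvgy_expRN (R : realType) (c : R) : 0 < c ->
  expR (- (c * t)) @[t --> +oo] --> (0 : R).
Proof.
move=> c0; apply: (cvg_comp _ _ _ (@cvgr_expR R)).
by apply: gt0_cvgMry => //; exact: cvg_id.
Qed.

Lemma is_derive_expRN (R : realType) (c t : R) :
  is_derive t 1 (fun t => expR (- (c * t))) (- c * expR (- (c * t))).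
Proof.
have h : is_derive t 1 (fun t => - (c * t)) (- c).
  by apply: is_derive_eq; rewrite ?scaler0 ?addr0 ?add0r -?[_ *: _]/(_ * _) mulr1.
by have := @is_derive1_comp _ expR (fun t => - (c * t)) t _ _
  (is_derive_expR (- (c * t))) h; rewrite mulrC.
Qed.

Lemma Rint0y_expRN (R : realType) (c : R) : 0 < c ->
  integrable0y (fun t => expR (- (c * t))) /\
  Rint0y (fun t => expR (- (c * t))) = c^-1.
Proof.
move=> c0; have cE : (fun t => expR (- (c * t))) = (fun t => expR (- c * t)).
  by apply/funext => t; rewrite mulNr.
have ce t : 0 < t -> {for t, continuous (fun t => expR (- (c * t)))}.
  by move=> _; rewrite cE; exact: continuous_expRM.
apply: integrable0y_ge0 => //.
have cV : c^-1 = 0 - (- c^-1) by rewrite sub0r opprK.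
rewrite [in RHS]cV; apply: (@integral_FTC_0y _ (fun t => - c^-1 * expR (- (c * t)))) => //.
- move=> t _; have := is_deriveZ (- c^-1) (is_derive_expRN c t).
  by rewrite -[_ *: _]/(_ * _) mulrA mulrNN mulVf ?mul1r ?gt_eqF.
- apply: cvg_at_right_filter; rewrite -[X in _ --> X]mulr1.
  apply: cvgM; first exact: cvg_cst.
  by have := @continuous_expRM R (- c) 0; rewrite cE /continuous_at mulr0 expR0.
- by rewrite -(mulr0 (- c^-1)); apply: cvgM; [exact: cvg_cst|exact: cvgy_expRN].
Qed.

(** The [O(d)] bounds and the Lipschitz bounds on integrals all reduce to this estimate. *)
Lemma integrable0y_dom (R : realType) (f : R -> R) (C c : R) : 0 < c ->
  (forall t : R, 0 < t -> {for t, continuous f}) ->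
  (forall t : R, 0 < t -> `|f t| <= C * expR (- (c * t))) ->
  integrable0y f /\ `|Rint0y f| <= C / c.
Proof.
move=> c0 cf fC; have [ei ev] := Rint0y_expRN c0.
have [gi gv] := Rint0yZ C ei.
have fi : integrable0y f.
  apply: le_integrable gi => //.
    by apply/measurable_EFinP; exact: continuous_measurable_0y.
  move=> t /=; rewrite in_itv/= andbT => t0.
  by rewrite lee_fin (le_trans (fC _ t0))// ler_norm.
split=> //; rewrite -ev -gv; apply: (le_trans (le_normr_Rintegral _ fi)) => //.
by apply: le_Rint0y => //; have := integrable_norm fi; apply.
Qed.

(* The lower bound on [f] makes [f + C exp (- c t)] nonnegative. *)
Lemma Rint0y_FTC (R : realType) (F f : R -> R) (l0 l C c : R) : 0 < c ->
  (forall t : R, 0 < t -> is_derive t 1 F (f t)) ->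
  (forall t : R, 0 < t -> {for t, continuous f}) ->
  (forall t : R, 0 < t -> - (C * expR (- (c * t))) <= f t) ->
  F t @[t --> 0^'+] --> l0 -> F t @[t --> +oo] --> l ->
  integrable0y f /\ Rint0y f = l - l0.
Proof.
move=> c0 dF cf fC F0 Fy.
have [ei ev] := Rint0yZ C (Rint0y_expRN c0).1.
pose G t := F t - C / c * expR (- (c * t)).
pose g t := f t + C * expR (- (c * t)).
have dG (t : R) : 0 < t -> is_derive t 1 G (g t).
  move=> t0; have := is_deriveB (dF _ t0) (is_deriveZ (C / c) (is_derive_expRN c t)).
  move/is_derive_eq; apply; rewrite /g -[_ *: _]/(_ * _); congr (_ + _).
  by field; rewrite gt_eqF.
have cg t : 0 < t -> {for t, continuous g}.
  by move=> t0; exact: (cvgD (cf _ t0) (@continuous_expRN _ C c t)).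
have g0 t : 0 < t -> 0 <= g t.
  by move=> t0; rewrite /g -[X in _ + X]opprK subr_ge0 fC.
have G0 : G t @[t --> 0^'+] --> l0 - C / c.
  apply: cvgB => //; apply: cvg_at_right_filter.
  by have := @continuous_expRN R (C / c) c 0; rewrite /continuous_at mulr0 oppr0 expR0 mulr1.
have Gy : G t @[t --> +oo] --> l - C / c * 0.
  by apply: cvgB => //; exact: (cvgM (cvg_cst _) (cvgy_expRN c0)).
have [gi gv] := integrable0y_ge0 cg g0 (integral_FTC_0y dG cg g0 G0 Gy).
have [fi fv] := Rint0yB gi ei.
have fE t : 0 < t -> g t - C * expR (- (c * t)) = f t by rewrite /g addrK.
split; first exact: integrable0y_eq fE fi.
rewrite -(Rint0y_eq fE) fv gv ev (Rint0y_expRN c0).2; ring.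
Qed.

Lemma Rint0y_subst (R : realType) (F f G : R -> R) :
  (forall t : R, 0 < t -> is_derive t 1 F (f t)) ->
  (forall t : R, 0 < t -> {for t, continuous f}) ->
  (forall t : R, 0 < t -> 0 <= f t) ->
  (forall s t : R, 0 < s -> s < t -> F s < F t) ->
  F t @[t --> 0^'+] --> 0 -> F t @[t --> +oo] --> +oo ->
  (forall t : R, 0 < t -> {for t, continuous G}) ->
  (forall t : R, 0 < t -> 0 <= G t) ->
  Rint0y G = Rint0y (fun t => G (F t) * f t) /\
  (integrable0y G -> integrable0y (fun t => G (F t) * f t)).
Proof.
move=> dF cf f0 iF F0 Fy cG G0.
have E := integral_subst_0y dF cf f0 iF F0 Fy cG G0.
split=> [|iG]; first by rewrite /Rintegral E.
have cF := derivable_continuous_0y dF.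
have Fpos (t : R) : 0 < t -> 0 < F t by move=> t0; exact: (increasing_0y_gt0 iF F0).
have [] := @integrable0y_ge0 R (fun t => G (F t) * f t) (Rint0y G) => //.
- move=> t t0; apply: cvgM; last exact: cf.
  by apply: continuous_comp; [exact: cF|apply: cG; exact: Fpos].
- by move=> t t0; rewrite mulr_ge0 ?f0// G0// Fpos.
- by rewrite -E /Rintegral fineK// integrable_fin_num.
Qed.

(** A single constant for all exponents in [[0, P]] makes later bounds uniform in [nu]. With
    [N > P], the power is at most 1 for [t <= 1]; for [t > 1] it is at most [t ^ N], which up to
    [N! / c ^ N] is one term of the series of [exp (c t)]. *)
Lemma powR_le_expR (R : realType) (P c : R) : 0 < c ->
  exists2 C : R, 0 < C &
    forall p t : R, 0 <= p <= P -> 0 < t -> t `^ p <= C * expR (c * t).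
Proof.
move=> c0; pose N := (Num.truncn P).+1.
exists (1 + N`!%:R / c ^+ N) => [|p t /andP[p0 pP] t0].
  by rewrite ltr_pwDl// divr_ge0// exprn_ge0// ltW.
rewrite mulrDl mul1r.
have e1 : 1 <= expR (c * t) by rewrite -expR0 ler_expR mulr_ge0// ltW.
have pN : p <= N%:R by rewrite (le_trans pP)// ltW// truncnS_gt.
have tN : t ^+ N <= N`!%:R / c ^+ N * expR (c * t).
  rewrite mulrAC ler_pdivlMr ?exprn_gt0// -exprMn [t * c]mulrC.
  have ct : 0 <= c * t by rewrite mulr_ge0// ltW.
  have := expR_ge1Dxn (Num.truncn P) ct; rewrite -/N => h.
  by rewrite -ler_pdivrMl ?ltr0n ?fact_gt0// [_^-1 * _]mulrC; apply: le_trans h; rewrite lerDr.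
have [t1|t1] := leP t 1.
  rewrite (@le_trans _ _ 1)//.
    by rewrite -(powRr0 t); apply: ger_powR => //; rewrite t0.
  by rewrite (le_trans e1)// lerDl (le_trans _ tN)// exprn_ge0// ltW.
rewrite (@le_trans _ _ (t ^+ N))//.
  by rewrite -powR_mulrn ?(ltW t0)//; apply: ler_powR => //; exact: ltW.
by rewrite (le_trans tN)// lerDr expR_ge0.
Qed.

Lemma continuous_powR (R : realType) (p t : R) : 0 < t ->
  {for t, continuous (fun t => t `^ p)}.
Proof.
move=> t0; apply: differentiable_continuous; apply/derivable1_diffP.
by apply: derivable_powR; rewrite in_itv/= t0.
Qed.

(** * The Gamma function *)

Lemma continuous_powR_expRN (R : realType) (p t : R) : 0 < t ->
  {for t, continuous (fun t => t `^ p * expR (- t))}.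
Proof.
move=> t0; apply: cvgM; first exact: continuous_powR.
apply: (@continuous_comp _ _ _ -%R expR); first exact: opp_continuous.
exact: continuous_expR.
Qed.

Lemma powR_expRN_le (R : realType) (P : R) :
  exists2 C : R, 0 < C &
    forall p t : R, 0 <= p <= P -> 0 < t ->
    t `^ p * expR (- t) <= C * expR (- (2^-1 * t)).
Proof.
have [C C0 hC] := @powR_le_expR R P 2^-1 ltac:(by rewrite invr_gt0).
exists C => // p t hp t0.
have -> : - (2^-1 * t) = 2^-1 * t - t by field.
by rewrite expRD mulrA ler_pM2r ?expR_gt0// hC.
Qed.

Lemma integrable_gamma1 (R : realType) (z : R) : 0 <= z ->
  integrable0y (fun t => t `^ z * expR (- t)).
Proof.
move=> z0; have [C C0 hC] := powR_expRN_le z.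
have := @integrable0y_dom R (fun t => t `^ z * expR (- t)) C 2^-1.
case=> //; first by move=> t; exact: continuous_powR_expRN.
move=> t t0; rewrite ger0_norm ?hC ?z0 ?lexx//.
by rewrite mulr_ge0 ?powR_ge0 ?expR_ge0.
Qed.

(** For [z < 1] the integrand is unbounded at 0 and has no exponential envelope. But the derivative
    [f] of [t ^ z exp (- t)] is bounded below by such an envelope, so [Rint0y_FTC] makes it
    integrable, and adding [t ^ z exp (- t)] back recovers the integrand. *)
Lemma integrable_gammaD1 (R : realType) (z : R) : 0 < z ->
  integrable0y (fun t => t `^ (z - 1) * expR (- t)) /\
  euler_integral (z + 1) = z * euler_integral z.
Proof.
move=> z0; have [C C0 hC] := powR_expRN_le z.
have zz : 0 <= z <= z by rewrite ltW/=.
pose F (t : R) := t `^ z * expR (- t).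
pose f (t : R) := z * (t `^ (z - 1) * expR (- t)) - t `^ z * expR (- t).
have dF (t : R) : 0 < t -> is_derive t 1 F (f t).
  move=> t0; have := is_deriveM (is_derive1_powR z t0) (is_derive_expRN 1 t).
  have -> : (fun t : R => t `^ z) * (fun t => expR (- (1 * t))) = F.
    by apply/funext => s; rewrite fctE mul1r.
  move/is_derive_eq; apply; rewrite /f -![_ *: _]/(_ * _) mul1r; ring.
have cf (t : R) : 0 < t -> {for t, continuous f}.
  move=> t0; apply: cvgB; last exact: continuous_powR_expRN.
  by apply: cvgM; [exact: cvg_cst|exact: continuous_powR_expRN].
have F0 : F t @[t --> 0^'+] --> 0.
  rewrite -[X in _ --> X](mul0r (expR (- 0))); apply: cvgM; first exact: powR_cvg0.
  apply: cvg_at_right_filter; apply: (@continuous_comp _ _ _ -%R expR).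
    exact: opp_continuous.
  exact: continuous_expR.
have Fy : F t @[t --> +oo] --> 0.
  apply: (@squeeze_cvgr _ _ _ _ (cst 0) (fun t => C * expR (- (2^-1 * t)))).
  - near=> t; rewrite mulr_ge0 ?powR_ge0 ?expR_ge0//= hC//.
  - exact: cvg_cst.
  - rewrite -[X in _ --> X](mulr0 C); apply: cvgM; first exact: cvg_cst.
    by apply: cvgy_expRN; rewrite invr_gt0.
have fC (t : R) : 0 < t -> - (C * expR (- (2^-1 * t))) <= f t.
  move=> t0; rewrite /f lerBrDl lerBlDr addrC (le_trans (hC _ _ zz t0))// lerDl.
  by rewrite !mulr_ge0 ?powR_ge0 ?expR_ge0// ltW.
have [fi fv] := Rint0y_FTC (ltac:(by rewrite invr_gt0) : 0 < 2^-1) dF cf fC F0 Fy.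
have ei := integrable_gamma1 (ltW z0).
have [si sv] := Rint0yD fi ei.
have [gi gv] := Rint0yZ z^-1 si.
have E (t : R) : 0 < t -> z^-1 * (f t + t `^ z * expR (- t)) = t `^ (z - 1) * expR (- t).
  by move=> _; rewrite /f; field; rewrite gt_eqF.
split; first exact: integrable0y_eq E gi.
rewrite /euler_integral addrK -(Rint0y_eq E) gv sv fv; field; by rewrite gt_eqF.
Unshelve. all: by end_near. Qed.

Lemma euler_integral1 (R : realType) : euler_integral (1 : R) = 1.
Proof.
have [_ v] := @Rint0y_expRN R 1 ltr01; rewrite -[RHS]invr1 -v.
by apply: Rint0y_eq => t _; rewrite subrr powRr0 !mul1r.
Qed.

(** * Convexity inequalities for the Gamma integral *)

(** Concavity of [ln]: both logarithms lie below the tangent at the mean [m], and the weighted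
    tangent values add up to [ln m]. *)
Lemma powR_weighted_AGM (R : realType) (s a b : R) : 0 <= s <= 1 -> 0 < a -> 0 < b ->
  a `^ s * b `^ (1 - s) <= s * a + (1 - s) * b.
Proof.
move=> /andP[s0 s1] a0 b0; pose m := s * a + (1 - s) * b.
have m0 : 0 < m.
  rewrite /m; have [->|sn0] := eqVneq s 0; first by rewrite mul0r add0r subr0 mul1r.
  have sp : 0 < s by rewrite lt_neqAle eq_sym sn0.
  apply: ltr_wpDr; last exact: mulr_gt0.
  by rewrite mulr_ge0 ?subr_ge0// ltW.
have lnm c : 0 < c -> ln c <= ln m + (c / m - 1).
  move=> c0; rewrite -lerBlDl -ln_div ?posrE//.
  have := @le_ln1Dx R (c / m - 1); rewrite addrCA subrr addr0; apply.
  by rewrite ltrBrDl subrr divr_gt0.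
rewrite -/m /powR !gt_eqF// -expRD -[leRHS](lnK (x := m)) ?posrE// ler_expR.
have h1 := ler_wpM2l s0 (lnm _ a0).
have h2 := ler_wpM2l (ltac:(by rewrite subr_ge0) : 0 <= 1 - s) (lnm _ b0).
apply: (le_trans (lerD h1 h2)).
rewrite le_eqVlt; apply/orP; left; apply/eqP.
transitivity (ln m + (m / m - 1)); last by rewrite divff ?gt_eqF// subrr addr0.
by have -> : m / m = (s * a + (1 - s) * b) / m by []; ring.
Qed.

(** The weighted mean inequality with weight [1 / p] between [t ^ p] and 1. *)
Lemma powR_Bernoulli (R : realType) (p t : R) : 1 <= p -> 0 < t ->
  1 + p * (t - 1) <= t `^ p.
Proof.
move=> p1 t0; have p0 : 0 < p by exact: lt_le_trans p1.
have /powR_weighted_AGM : 0 <= p^-1 <= 1 by rewrite invr_ge0 ltW//= invf_le1.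
move=> /(_ _ _ (powR_gt0 p t0) ltr01).
rewrite -powRrM divff ?gt_eqF// powRr1 ?(ltW t0)// powR1 !mulr1.
rewrite -(ler_pM2l p0) mulrDr mulrA mulrBr divff ?gt_eqF// => h; lra.
Qed.

(** By Bernoulli [t ^ (z - 1)] is at least [(2 - z) + (z - 1) t], and both 1 and [t] integrate to 1
    against [exp (- t)]. *)
Lemma euler_integral_ge1 (R : realType) (z : R) : 2 <= z -> 1 <= euler_integral z.
Proof.
move=> z2; have z0 : 0 < z by lra.
have [e0 v0] := @Rint0y_expRN R 1 ltr01.
have [_ v1] := @integrable_gammaD1 R 1 ltr01.
have e1 := @integrable_gamma1 R 1 ler01.
have [e2 v2] := Rint0yZ (2 - z) e0; have [e3 v3] := Rint0yZ (z - 1) e1.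
have [e4 v4] := Rint0yD e2 e3.
have E : Rint0y (fun t : R => t `^ 1 * expR (- t)) = 1.
  by move: v1; rewrite euler_integral1 mul1r /euler_integral addrK.
have -> : 1 = (2 - z) * 1^-1 + (z - 1) * 1 :> R by rewrite invr1; ring.
rewrite -{1}v0 -{4}E -v2 -v3 -v4; apply: le_Rint0y => //.
  by have [] := integrable_gammaD1 z0.
move=> t t0; rewrite mul1r mulrA -mulrDl ler_pM2r ?expR_gt0// powRr1 ?(ltW t0)//.
have z1 : 1 <= z - 1 by rewrite lerBrDl.
have := powR_Bernoulli z1 t0; congr (_ <= _); ring.
Qed.

Lemma euler_integral_gt0 (R : realType) (z : R) : 0 < z -> 0 < euler_integral z.
Proof.
move=> z0; have z1 : 0 < z + 1 by lra.
have z2 : 2 <= z + 1 + 1 by lra.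
have [_ v1] := integrable_gammaD1 z0; have [_ v2] := integrable_gammaD1 z1.
have := euler_integral_ge1 z2.
move/(lt_le_trans ltr01); rewrite v2 v1.
by rewrite !pmulr_rgt0.
Qed.

(** The mean inequality between [t] and [z] gives [t ^ s <= z ^ (s - 1) (s t + (1 - s) z)]. Against
    [t ^ (z - 1) exp (- t)] the bracket integrates to [z Gamma z], because
    [Gamma (z + 1) = z Gamma z]. *)
Lemma euler_integral_log_convex (R : realType) (z s : R) : 0 < z -> 0 <= s <= 1 ->
  euler_integral (z + s) <= z `^ s * euler_integral z.
Proof.
move=> z0 s01; have /andP[s0 s1] := s01.
have [iz vz] := integrable_gammaD1 z0; have i1 := integrable_gamma1 (ltW z0).
have [is_ _] := integrable_gammaD1 (ltr_wpDr s0 z0).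
have [j1 w1] := Rint0yZ s i1; have [j2 w2] := Rint0yZ ((1 - s) * z) iz.
have [j3 w3] := Rint0yD j1 j2; have [j4 w4] := Rint0yZ (z `^ s / z) j3.
have E1 : Rint0y (fun t : R => t `^ z * expR (- t)) = euler_integral (z + 1).
  by rewrite /euler_integral addrK.
have : euler_integral (z + s) <= Rint0y (fun t : R => z `^ s / z *
    (s * (t `^ z * expR (- t)) + (1 - s) * z * (t `^ (z - 1) * expR (- t)))).
  apply: le_Rint0y => // t t0.
  have zE : t `^ z = t * t `^ (z - 1) by rewrite mulr_powRB1// ltW.
  have -> : z + s - 1 = (z - 1) + s by ring.
  rewrite zE powRD ?(gt_eqF t0) ?implybT//.
  have h := powR_weighted_AGM s01 t0 z0.
  rewrite (@powRB _ z) ?(gt_eqF z0) ?implybT// (powRr1 (ltW z0)) in h.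
  have zs : 0 < z `^ s by rewrite powR_gt0.
  have h' : t `^ s <= z `^ s / z * (s * t + (1 - s) * z).
    rewrite -[z `^ s / z]invf_div -ler_pdivrMl ?invr_gt0 ?divr_gt0// invrK.
    by rewrite mulrC.
  rewrite mulrAC.
  have -> : s * (t * t `^ (z - 1) * expR (- t)) +
    (1 - s) * z * (t `^ (z - 1) * expR (- t)) =
    (s * t + (1 - s) * z) * (t `^ (z - 1) * expR (- t)) by ring.
  rewrite mulrA mulrC; apply: ler_wpM2r => //.
  by rewrite mulr_ge0 ?powR_ge0 ?expR_ge0.
move/le_trans; apply; rewrite w4 w3 w1 w2 E1 vz -/(euler_integral z).
rewrite le_eqVlt; apply/orP; left; apply/eqP; field; by rewrite gt_eqF.
Qed.

(** * Gaussian moments and the duplication formula *)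

Lemma continuous_gauss_moment (R : realType) (p t : R) : 0 < t ->
  {for t, continuous (fun s => s `^ p * expR (- s ^+ 2))}.
Proof.
move=> t0; apply: cvgM; first exact: continuous_powR.
exact: continuous_gauss_fun.
Qed.

Lemma integrable_gauss_moment (R : realType) (p : R) : 0 <= p ->
  integrable0y (fun s => s `^ p * expR (- s ^+ 2)).
Proof.
move=> p0; have [C C0 hC] := @powR_le_expR R p 2^-1 ltac:(by rewrite invr_gt0).
have [] := @integrable0y_dom R (fun s => s `^ p * expR (- s ^+ 2))
  (C * expR 1) 2^-1 => //; first by move=> t; exact: continuous_gauss_moment.
move=> t t0; rewrite ger0_norm ?mulr_ge0 ?powR_ge0 ?expR_ge0//.
apply: (@le_trans _ _ (C * expR (2^-1 * t) * expR (- t ^+ 2))).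
  by rewrite ler_pM2r ?expR_gt0// hC ?p0 ?lexx.
rewrite -!mulrA -!expRD ler_pM2l// ler_expR.
have : 0 <= (t - 2^-1) ^+ 2 by exact: sqr_ge0.
lra.
Qed.

(** The substitution [t = s ^ 2]. *)
Lemma euler_integral_half (R : realType) (q : R) :
  euler_integral (q / 2) = Rint0y (fun s => 2 * (s `^ (q - 1) * expR (- s ^+ 2))).
Proof.
have dF (t : R) : 0 < t -> is_derive t 1 (fun s : R => s ^+ 2) (2 * t).
  by move=> _; apply: is_derive_eq; rewrite -[_%:A]/(_ * _) mulr1; ring.
rewrite /euler_integral (Rint0y_subst dF _ _ _ _ _ _ _).1.
- apply: Rint0y_eq => s s0; rewrite -powR_mulrn ?(ltW s0)// -powRrM.
  rewrite [2%:R * _](_ : _ = (q - 1) - 1); last by field.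
  have -> : s `^ (q - 1) = s * s `^ (q - 1 - 1).
    rewrite -[X in X * _](powRr1 (ltW s0)) -powRD ?(gt_eqF s0) ?implybT//.
    by congr (_ `^ _); ring.
  ring.
- by move=> t _; exact: mulrl_continuous.
- by move=> t t0; rewrite mulr_ge0// ltW.
- by move=> s t s0 st; rewrite ltr_pXn2r// nnegrE ltW// (lt_trans s0).
- apply: cvg_at_right_filter; rewrite -[X in _ --> X](expr0n _ 2).
  exact: exprn_continuous.
- exact: cvgr_expr2.
- by move=> t; exact: continuous_powR_expRN.
- by move=> t _; rewrite mulr_ge0 ?powR_ge0 ?expR_ge0.
Qed.

(* Keeps unification and [lra] from unfolding Lebesgue integrals. *)
Opaque euler_integral.

(* The ratio of the two sides of the duplication formula has period 1, and log-convexity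
   of Gamma forces it to be constant, as in the Bohr-Mollerup theorem. *)
Definition duplication_ratio (R : realType) (z : R) : R :=
  2 `^ z * euler_integral (z / 2) * euler_integral ((z + 1) / 2) / euler_integral z.

Lemma duplication_ratio_gt0 (R : realType) (z : R) : 0 < z -> 0 < duplication_ratio z.
Proof.
move=> z0; rewrite /duplication_ratio divr_gt0 ?euler_integral_gt0//.
by rewrite !mulr_gt0 ?powR_gt0 ?euler_integral_gt0 ?divr_gt0 ?ltr_wpDr.
Qed.

Lemma duplication_ratioD1 (R : realType) (z : R) : 0 < z ->
  duplication_ratio (z + 1) = duplication_ratio z.
Proof.
move=> z0; have [_ v] := integrable_gammaD1 z0.
have [_ v2] := @integrable_gammaD1 R (z / 2) ltac:(by rewrite divr_gt0).
have e0 := gt_eqF (euler_integral_gt0 z0).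
rewrite /duplication_ratio v powRD ?pnatr_eq0 ?implybT// powRr1//.
have -> : (z + 1 + 1) / 2 = z / 2 + 1 by field.
rewrite v2; move: e0; set a := euler_integral z; set b := euler_integral (z / 2).
set c := euler_integral ((z + 1) / 2); clearbody a b c => e0.
by field; rewrite e0 gt_eqF.
Qed.

Lemma duplication_ratioDn (R : realType) (z : R) (n : nat) : 0 < z ->
  duplication_ratio (z + n%:R) = duplication_ratio z.
Proof.
move=> z0; elim: n => [|n IH]; first by rewrite addr0.
by rewrite -natr1 addrA duplication_ratioD1// ltr_wpDr.
Qed.

(** Log-convexity with step [s / 2] bounds the two numerator factors from above; with step [1 - s],
    from [z + s] to [z + 1], it bounds the denominator from below. The loss [(z + 1) / z] tends to 1
    at infinity. *)
Lemma duplication_ratio_shift_le (R : realType) (z s : R) : 0 < z -> 0 <= s <= 1 ->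
  duplication_ratio (z + s) <= duplication_ratio z * ((z + 1) / z).
Proof.
move=> z0 s01; have /andP[s0 s1] := s01.
have s2 : 0 <= s / 2 <= 1 by lra.
have zs0 : 0 < z + s by rewrite ltr_wpDr.
have z20 : 0 < z / 2 by lra.
have z120 : 0 < (z + 1) / 2 by lra.
have z2s0 : 0 < z / 2 + s / 2 by lra.
have z12s0 : 0 < (z + 1) / 2 + s / 2 by lra.
have z1p : 0 < z + 1 by lra.
have z10 : 0 <= z + 1 by exact: ltW.
have zz1 : z <= z + 1 by lra.
have zs1 : z + s <= z + 1 by lra.
have s20 : 0 <= s / 2 by lra.
have s10 : 0 <= 1 - s by lra.
have s1' : 0 <= 1 - s <= 1 by lra.
have h1 := euler_integral_log_convex z20 s2.
have h2 := euler_integral_log_convex z120 s2.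
have h3 := euler_integral_log_convex zs0 s1'.
have [_ v] := integrable_gammaD1 z0.
have zz : z + s + (1 - s) = z + 1 by ring.
rewrite zz v in h3.
have E1 : (z + s) / 2 = z / 2 + s / 2 by field.
have E2 : (z + s + 1) / 2 = (z + 1) / 2 + s / 2 by field.
rewrite /duplication_ratio E1 E2.
set A := euler_integral (z / 2) in h1 *; set B := euler_integral ((z + 1) / 2) in h2 *.
set G := euler_integral z in h3 *; set Gs := euler_integral (z + s) in h3 *.
have A0 : 0 < A by exact: euler_integral_gt0.
have B0 : 0 < B by exact: euler_integral_gt0.
have G0 : 0 < G by apply: euler_integral_gt0.
have Gs0 : 0 < Gs by apply: euler_integral_gt0.
have h12 : euler_integral (z / 2 + s / 2) * euler_integral ((z + 1) / 2 + s / 2) <=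
   (z / 2) `^ (s / 2) * A * (((z + 1) / 2) `^ (s / 2) * B).
  exact: (ler_pM (ltW (euler_integral_gt0 z2s0)) (ltW (euler_integral_gt0 z12s0)) h1 h2).
clearbody A B G Gs; clear h1 h2 v.
(* Once the powers of 2 are absorbed, every base is at most [z + 1], and the exponents [s / 2],
   [s / 2] and [1 - s] add up to 1. *)
have key : 2 `^ s * (z / 2) `^ (s / 2) * ((z + 1) / 2) `^ (s / 2) * (z + s) `^ (1 - s) <= z + 1.
  have e2 : 2 `^ s = 2 `^ (s / 2) * 2 `^ (s / 2) :> R.
    by rewrite -powRD ?pnatr_eq0 ?implybT//; congr powR; field.
  have e3 : 2 `^ s * (z / 2) `^ (s / 2) * ((z + 1) / 2) `^ (s / 2) =
      z `^ (s / 2) * (z + 1) `^ (s / 2).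
    have -> : z `^ (s / 2) = 2 `^ (s / 2) * (z / 2) `^ (s / 2).
      by rewrite -powRM ?divr_ge0 ?(ltW z0)//; congr (_ `^ _); field.
    have -> : (z + 1) `^ (s / 2) = 2 `^ (s / 2) * ((z + 1) / 2) `^ (s / 2).
      by rewrite -powRM ?(ltW z120)//; congr (_ `^ _); field.
    by rewrite e2; ring.
  rewrite e3.
  apply: (@le_trans _ _ ((z + 1) `^ (s / 2) * (z + 1) `^ (s / 2) * (z + 1) `^ (1 - s))).
    apply: ler_pM; rewrite ?mulr_ge0 ?powR_ge0//.
      by apply: ler_wpM2r; rewrite ?powR_ge0//; apply: ge0_ler_powR; rewrite ?nnegrE ?(ltW z0).
    by apply: ge0_ler_powR; rewrite ?nnegrE ?(ltW zs0).
  have zp : (z + 1 == 0) = false by rewrite gt_eqF.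
  rewrite -!powRD ?zp ?implybT//.
  have -> : s / 2 + s / 2 + (1 - s) = 1 by field.
  by rewrite powRr1.
rewrite ler_pdivrMr// powRD ?pnatr_eq0 ?implybT// -!mulrA.
apply: (@le_trans _ _ (2 `^ z * (2 `^ s *
  ((z / 2) `^ (s / 2) * A * (((z + 1) / 2) `^ (s / 2) * B))))).
  rewrite !(ler_pM2l (powR_gt0 _ (ltr0Sn _ 1))); exact: h12.
have -> : 2 `^ z * (A * (B * (G^-1 * ((z + 1) * (z^-1 * Gs))))) =
  2 `^ z * (A * B) * ((z + 1) * (Gs / (z * G))).
  by field; rewrite !gt_eqF.
have -> : 2 `^ z * (2 `^ s * ((z / 2) `^ (s / 2) * A * (((z + 1) / 2) `^ (s / 2) * B))) =
  2 `^ z * (A * B) * (2 `^ s * (z / 2) `^ (s / 2) * ((z + 1) / 2) `^ (s / 2)) by ring.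
rewrite ler_pM2l ?mulr_gt0 ?powR_gt0//.
set K := 2 `^ s * _ * _ in key *.
have K0 : 0 <= K by rewrite !mulr_ge0 ?powR_ge0.
rewrite mulrA ler_pdivlMr ?mulr_gt0//.
apply: (le_trans (ler_wpM2l K0 h3)); rewrite mulrA.
by apply: ler_wpM2r => //; exact: ltW.
Qed.

(** By periodicity the previous estimate may be applied at [z + n], where its loss tends to 1; this
    gives one inequality. The reverse one is the same inequality for the step [1 - s] from [z + s]
    to [z + 1]. *)
Lemma duplication_ratio_cst (R : realType) (z s : R) : 0 < z -> 0 <= s <= 1 ->
  duplication_ratio (z + s) = duplication_ratio z.
Proof.
have lim (d d' w : R) : 0 < d -> 0 < w ->
    (forall n : nat, d' <= d * ((w + n%:R + 1) / (w + n%:R))) -> d' <= d.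
  move=> d0 w0 h; rewrite -[leRHS]mulr1 -ler_pdivrMl//.
  apply/ler_addgt0Pr => e e0.
  have [n ne] : exists n, e^-1 <= n%:R.
    exists (Num.truncn e^-1).+1; apply: ltW; exact: truncnS_gt.
  have := h n; rewrite -ler_pdivrMl// => /le_trans; apply.
  have n0 : 0 < w + n%:R by rewrite ltr_wpDr.
  rewrite mulrDl divff ?(gt_eqF n0)// lerD2l div1r -[leRHS]invrK.
  by rewrite lef_pV2 ?posrE ?invr_gt0// (le_trans ne)// lerDr ltW.
have le z' s' : 0 < z' -> 0 <= s' <= 1 ->
    duplication_ratio (z' + s') <= duplication_ratio z' :> R.
  move=> z0 s01; apply: (lim _ _ z') => //; first exact: duplication_ratio_gt0.
  move=> n; have z'n : 0 < z' + n%:R by rewrite ltr_wpDr.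
  have z's : 0 < z' + s' by case/andP: s01 => s0 _; rewrite ltr_wpDr.
  have := duplication_ratio_shift_le z'n s01.
  by rewrite addrAC !duplication_ratioDn.
move=> z0 s01; apply/eqP; rewrite eq_le le//=.
rewrite -(duplication_ratioD1 z0).
have -> : z + 1 = (z + s) + (1 - s) by ring.
by apply: le; [case/andP: s01 => s0 _; rewrite ltr_wpDr|lra].
Qed.

Lemma Rint0y_gauss_moment (R : realType) (q : R) : 1 <= q ->
  Rint0y (fun s => s `^ (q - 1) * expR (- s ^+ 2)) = euler_integral (q / 2) / 2.
Proof.
move=> q1; rewrite euler_integral_half.
have [_ ->] := @Rint0yZ R 2 _ (@integrable_gauss_moment R (q - 1) ltac:(lra)).
by rewrite mulrC mulKf.
Qed.

Lemma euler_integral12 (R : realType) : euler_integral (1 / 2 : R) = Num.sqrt pi.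
Proof.
have h := @Rint0y_gauss_moment R 1 (lexx _).
have -> : Num.sqrt pi = 2 * (Num.sqrt pi / 2) :> R by field.
rewrite -[euler_integral _](divfK (_ : 2 != 0))// mulrC -h; congr (_ * _).
have /(congr1 fine) /= <- := @integral0y_gauss R.
rewrite -integral_itv_obnd_cbnd; last first.
  by apply/measurable_EFinP/measurable_funTS; exact: measurable_gauss_fun.
by apply: Rint0y_eq => t t0; rewrite subrr powRr0 mul1r.
Qed.

Lemma euler_integral_duplication (R : realType) (z : R) : 0 < z ->
  euler_integral (z / 2) * euler_integral ((z + 1) / 2) =
  2 `^ (1 - z) * Num.sqrt pi * euler_integral z.
Proof.
move=> z0.
have D1 : duplication_ratio (1 : R) = 2 * Num.sqrt pi.
  rewrite /duplication_ratio euler_integral12 powRr1// euler_integral1 divff//.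
  by rewrite euler_integral1 divr1 mulr1.
have Dz : duplication_ratio z = duplication_ratio 1.
  have fz : 0 <= z - (Num.truncn z)%:R <= 1.
    by have := truncn_itv (ltW z0); rewrite -natr1; lra.
  (* The base point [1 + floor z] is positive even for [z < 1]; adding the fractional part gives
     [z + 1], one period away from [z]. *)
  have n0 : (0 : R) < 1 + (Num.truncn z)%:R by rewrite ltr_wpDr.
  have := duplication_ratio_cst n0 fz.
  rewrite [X in duplication_ratio X = _](_ : _ = z + 1); last by ring.
  by rewrite (duplication_ratioD1 z0) (duplication_ratioDn _ ltr01).
move: Dz.
have p2 : 0 < 2 `^ z :> R by rewrite powR_gt0.
have -> : 2 `^ (1 - z) = 2 / 2 `^ z :> R.
  by rewrite powRB ?pnatr_eq0 ?implybT// powRr1.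
rewrite D1 /duplication_ratio; have := euler_integral_gt0 z0.
move: (euler_integral (z / 2)) (euler_integral ((z + 1) / 2)) (euler_integral z).
move: (2 `^ z) (Num.sqrt pi) p2 => b r b0 A B G G0 h.
have E : b * A * B = 2 * r * G by rewrite -h; field; rewrite gt_eqF.
apply: (mulfI (lt0r_neq0 b0)); rewrite mulrA E.
by field; rewrite gt_eqF.
Qed.

(** * Rising factorials and the reciprocal Gamma function *)

Lemma pochhammerS (R : realType) (a : R) k :
  pochhammer a k.+1 = pochhammer a k * (a + k%:R).
Proof. by rewrite /pochhammer big_ord_recr. Qed.

Lemma pochhammerSl (R : realType) (a : R) k :
  pochhammer a k.+1 = a * pochhammer (a + 1) k.
Proof.
rewrite /pochhammer big_ord_recl addr0; congr (_ * _); apply: eq_bigr => i _.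
by rewrite lift0 -nat1r addrA.
Qed.

Lemma pochhammer_gt0 (R : realType) (a : R) k : 0 < a -> 0 < pochhammer a k.
Proof.
move=> a0; elim: k => [|k IH]; first by rewrite /pochhammer big_ord0.
by rewrite pochhammerS mulr_gt0// ltr_wpDr.
Qed.

Lemma euler_integralDn (R : realType) (z : R) k : 0 < z ->
  euler_integral (z + k%:R) = pochhammer z k * euler_integral z.
Proof.
move=> z0; elim: k => [|k IH]; first by rewrite /pochhammer big_ord0 addr0 mul1r.
have zk : 0 < z + k%:R by rewrite ltr_wpDr.
have [_ v] := integrable_gammaD1 zk.
by rewrite -natr1 addrA v IH pochhammerS; ring.
Qed.

Lemma pochhammerDn (R : realType) (a : R) m n :
  pochhammer a (m + n) = pochhammer a m * pochhammer (a + m%:R) n.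
Proof.
elim: n => [|n IH]; first by rewrite addn0 [pochhammer _ 0]big_ord0 mulr1.
by rewrite addnS !pochhammerS IH natrD; ring.
Qed.

Lemma gamma_shift_gt0 (R : realType) (z : R) : 0 < z + (gamma_shift z)%:R.
Proof.
rewrite /gamma_shift; case: ifPn => [z0|]; first by rewrite addr0.
by rewrite -leNgt => z0; rewrite -ltrBlDl sub0r truncnS_gt.
Qed.

(** Any admissible shift may replace the least one, since both agree with the total shift. In
    reciprocal form this covers the poles, where the rising factorial vanishes. *)
Lemma invr_Gamma (R : realType) (z : R) (n : nat) : 0 < z + n%:R ->
  (Gamma z)^-1 = pochhammer z n / euler_integral (z + n%:R).
Proof.
move=> zn0; set m := gamma_shift z; have zm0 := gamma_shift_gt0 z.
have shift k l : 0 < z + k%:R ->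
    pochhammer z k / euler_integral (z + k%:R) =
    pochhammer z (k + l) / euler_integral (z + (k + l)%:R).
  move=> zk0; rewrite natrD addrA (euler_integralDn l zk0) pochhammerDn.
  have := pochhammer_gt0 l zk0; have := euler_integral_gt0 zk0.
  move: (euler_integral _) (pochhammer (_ + _) l) (pochhammer z k) => a b c a0 b0.
  by field; rewrite !gt_eqF.
rewrite /Gamma invf_div (shift _ n zm0) (shift _ m zn0).
by rewrite addnC.
Qed.

Lemma invr_GammaS (R : realType) (z : R) : (Gamma z)^-1 = z * (Gamma (z + 1))^-1.
Proof.
set n := gamma_shift (z + 1); have zn0 : 0 < z + 1 + n%:R := gamma_shift_gt0 (z + 1).
have E : z + n.+1%:R = z + 1 + n%:R by rewrite -nat1r addrA.
by rewrite (@invr_Gamma _ z n.+1) ?E// (invr_Gamma zn0) pochhammerSl mulrA.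
Qed.

Lemma Gamma_gt0E (R : realType) (z : R) : 0 < z -> Gamma z = euler_integral z.
Proof.
move=> z0; apply: invr_inj.
by rewrite (@invr_Gamma _ z 0) addr0// [pochhammer _ _]big_ord0 div1r.
Qed.

(** * Kummer and Hermite functions *)

Definition kummer_term (R : realType) (a b z : R) (k : nat) : R :=
  pochhammer a k / pochhammer b k * (z ^+ k / k`!%:R).

(** With [C = |a| / b + 1] one has [|a + i| <= C (b + i)], so the quotient of rising factorials is
    at most [C ^ k] and the exponential series of [C |z|] dominates. *)
Lemma cvg_kummerM (R : realType) (a b z : R) : 0 < b ->
  series (kummer_term a b z) @ \oo --> kummerM a b z.
Proof.
move=> b0; pose C := `|a| / b + 1.
have C0 : 0 <= C by rewrite addr_ge0// divr_ge0// ltW.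
have aC i : `|a + i%:R| <= C * (b + i%:R).
  have -> : C * (b + i%:R) = `|a| + i%:R + (`|a| / b * i%:R + b).
    by rewrite /C; field; rewrite gt_eqF.
  rewrite (le_trans (ler_normD _ _))// normr_nat lerDl.
  by rewrite addr_ge0 ?(ltW b0)// mulr_ge0// divr_ge0// ltW.
have pC k : `|pochhammer a k| <= C ^+ k * pochhammer b k.
  elim: k => [|k IH]; first by rewrite /pochhammer !big_ord0 normr1 mul1r.
  rewrite !pochhammerS normrM exprSr mulrACA.
  by apply: ler_pM.
apply: (@normed_cvg _ R^o).
apply: (@series_le_cvg _ _ (exp_coeff (C * `|z|))).
- by move=> k; exact: normr_ge0.
- by move=> k; rewrite /exp_coeff /= divr_ge0// exprn_ge0// mulr_ge0.
- move=> k; rewrite /kummer_term /exp_coeff /= !normrM !normfV normrX normr_nat.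
  rewrite (gtr0_norm (pochhammer_gt0 k b0)) exprMn -[leRHS]mulrA.
  apply: ler_wpM2r; first by rewrite divr_ge0// exprn_ge0.
  by rewrite ler_pdivrMr// pochhammer_gt0.
- exact: is_cvg_series_exp_coeff.
Qed.

(** At index [k + 1] the rising factorials of [a] and [a - 1] differ by [k + 1] times that of [a] at
    index [k]. This factor cancels against [(k + 1)!] and shifts the index, hence partial sums of
    lengths [n + 1] and [n]. *)
Lemma kummerM_contiguous_a (R : realType) (a b z : R) : 0 < b ->
  kummerM (a - 1) b z = kummerM a b z - z / b * kummerM a (b + 1) z.
Proof.
move=> b0; have b10 : 0 < b + 1 by rewrite ltr_wpDr.
have h1 := @cvg_kummerM _ (a - 1) _ z b0.
have h2 : series (kummer_term a b z) n.+1 @[n --> \oo] --> kummerM a b z.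
  by rewrite (cvg_shiftS (series (kummer_term a b z))); exact: cvg_kummerM.
have h3 := @cvg_kummerM _ a _ z b10.
rewrite -(cvg_shiftS (series _)) in h1.
have h4 := cvgB h2 (cvgM (cvg_cst (z / b)) h3).
rewrite -(cvg_lim _ h1)//; apply/cvg_lim => //.
rewrite [X in X @ \oo --> _](_ : _ =
  series (kummer_term a b z) \o S - cst (z / b) * series (kummer_term a (b + 1) z));
  first by apply: h4.
apply/funext => n; rewrite /= /series /= !fctE /= !big_nat_recl// mulr_sumr.
rewrite -addrA -sumrB; congr (_ + _).
  by rewrite /kummer_term /pochhammer !big_ord0.
apply: eq_bigr => k _; rewrite /kummer_term (pochhammerSl (a - 1)) subrK (pochhammerS a).
rewrite !(pochhammerSl b) factS natrM exprS.
have := pochhammer_gt0 k b10.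
have : k`!%:R != 0 :> R by rewrite pnatr_eq0 -lt0n fact_gt0.
move: (pochhammer a k) (pochhammer _ k) (k`!%:R) (z ^+ k) => u v w y w0 v0.
by rewrite -nat1r; field; rewrite w0 nat1r pnatr_eq0 !gt_eqF.
Qed.

(** Termwise, from [b (b + 1)_k = (b + k) (b)_k] and the same identity for [a]. *)
Lemma kummerM_contiguous_b (R : realType) (a b z : R) : 0 < b ->
  (b - a) * kummerM a (b + 1) z = b * kummerM a b z - a * kummerM (a + 1) (b + 1) z.
Proof.
move=> b0; have b10 : 0 < b + 1 by rewrite ltr_wpDr.
have h1 : (cst (b - a) * series (kummer_term a (b + 1) z)) n @[n --> \oo] -->
    (b - a) * kummerM a (b + 1) z.
  by apply: (cvgM (cvg_cst (b - a))); exact: cvg_kummerM.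
have h2 := cvgB (cvgM (cvg_cst b) (@cvg_kummerM _ a _ z b0))
  (cvgM (cvg_cst a) (@cvg_kummerM _ (a + 1) _ z b10)).
rewrite -(cvg_lim _ h1)//; apply/cvg_lim => //.
rewrite [X in X @ \oo --> _](_ : _ = cst b * series (kummer_term a b z) -
  cst a * series (kummer_term (a + 1) (b + 1) z)); first by apply: h2.
apply/funext => n; rewrite /series /= !fctE !mulr_sumr -sumrB; apply: eq_bigr => k _.
rewrite /kummer_term.
have E1 : b * pochhammer (b + 1) k = pochhammer b k * (b + k%:R).
  by rewrite -pochhammerSl pochhammerS.
have E2 : a * pochhammer (a + 1) k = pochhammer a k * (a + k%:R).
  by rewrite -pochhammerSl pochhammerS.
have := pochhammer_gt0 k b0; have := pochhammer_gt0 k b10.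
have : k`!%:R != 0 :> R by rewrite pnatr_eq0 -lt0n fact_gt0.
move: E1 E2.
move: (pochhammer a k) (pochhammer b k) (pochhammer (a + 1) k) (pochhammer (b + 1) k).
move: (k`!%:R) (z ^+ k) => w y u v u' v' E1 E2 w0 v'0 v0.
have E3 : b / v = (b + k%:R) / v'.
  by apply/eqP; rewrite eqr_div ?lt0r_neq0// E1 mulrC.
rewrite [RHS](_ : _ = (u * (b / v) - (a * u') / v') * (y / w)); last first.
  by field; rewrite w0 !gt_eqF.
by rewrite E3 E2; field; rewrite w0 gt_eqF.
Qed.

(** The functional equation of [1 / Gamma] reduces four Gamma factors to two; comparing the
    coefficients of each leaves exactly one of the contiguous relations at [b = 1 / 2]. *)
Lemma hermite_recurrence (R : realType) (nu x : R) :
  hermite (nu + 1) x = 2 * x * hermite nu x - 2 * nu * hermite (nu - 1) x.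
Proof.
have p0 : 0 < 2^-1 :> R by rewrite invr_gt0.
have eg : (Gamma (- (nu / 2)))^-1 = - (nu / 2) * (Gamma ((1 - (nu - 1)) / 2))^-1.
  by rewrite invr_GammaS; congr (_ * (Gamma _)^-1); field.
have eh : (Gamma (- ((nu + 1) / 2)))^-1 = - ((nu + 1) / 2) * (Gamma ((1 - nu) / 2))^-1.
  by rewrite invr_GammaS; congr (_ * (Gamma _)^-1); field.
have k1 := @kummerM_contiguous_a R ((1 - nu) / 2) (1 / 2) (x ^+ 2) ltac:(lra).
have k2 := @kummerM_contiguous_b R (- (nu / 2)) (1 / 2) (x ^+ 2) ltac:(lra).
have e1 : (1 - nu) / 2 - 1 = - ((nu + 1) / 2) by field.
have e2 : 1 / 2 + 1 = 3 / 2 :> R by field.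
have e3 : - (nu / 2) + 1 = (1 - (nu - 1)) / 2 by field.
rewrite e1 e2 in k1; rewrite e2 e3 in k2.
have e4 : (1 - (nu + 1)) / 2 = - (nu / 2) by field.
have e5 : - ((nu - 1) / 2) = (1 - nu) / 2 by field.
have p1 : 2 `^ (nu + 1) = 2 * 2 `^ nu :> R.
  by rewrite powRD ?pnatr_eq0 ?implybT// powRr1// mulrC.
have p2 : 2 `^ (nu - 1) = 2 `^ nu / 2 :> R.
  by rewrite powRB ?pnatr_eq0 ?implybT// powRr1.
rewrite /hermite p1 p2 e4 e5 k1 eh eg.
move: k2; move: (kummerM _ _ _) (kummerM _ _ _) (kummerM _ _ _) (kummerM _ _ _).
move=> m1 m2 m3 m4 k2; move: (kummerM _ _ _) => m5.
move: (Gamma _)^-1 (Gamma _)^-1 (2 `^ _) (Num.sqrt _) => g h p r.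
have E : (nu + 1) * m4 = m3 + nu * m2.
  rewrite [LHS](_ : _ = 2 * ((1 / 2 - - (nu / 2)) * m4)); last by field.
  by rewrite k2; field.
rewrite [LHS](_ : _ = 2 * p * r * (- (nu / 2) * h * (m1 - x ^+ 2 / (1 / 2) * m5)) +
  2 * p * r * x * g * ((nu + 1) * m4)); last by field.
by rewrite E; field.
Qed.

(** * The integral representation of the Hermite function *)

Lemma cvg_Rint0y_dominated (R : realType) (f_ : nat -> R -> R) (f g : R -> R) :
  (forall n, integrable0y (f_ n)) -> integrable0y f -> integrable0y g ->
  (forall t : R, 0 < t -> f_ n t @[n --> \oo] --> f t) ->
  (forall n (t : R), 0 < t -> `|f_ n t| <= g t) ->
  Rint0y (f_ n) @[n --> \oo] --> Rint0y f.
Proof.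
move=> fi ifi gi ff fg.
have [] := @dominated_convergence _ _ R lebesgue_measure `]0%R, +oo[%classic
  (measurable_itv _) (fun n => EFin \o f_ n) (EFin \o f) (EFin \o g).
- by move=> n; have /integrableP[] := fi n.
- by have /integrableP[] := ifi.
- apply/aeW => t /=; rewrite in_itv/= andbT => t0.
  by apply: cvg_EFin; [exact: nearW|exact: ff].
- exact: gi.
- apply/aeW => t n /=; rewrite in_itv/= andbT => t0.
  by rewrite lee_fin fg.
move=> _ _ h; apply: fine_cvg; rewrite fineK//.
by apply: integrable_fin_num.
Qed.

Lemma fact_even_pochhammer (R : realType) (j : nat) :
  (j.*2)`!%:R = 4 ^+ j * j`!%:R * pochhammer (1 / 2 : R) j.
Proof.
elim: j => [|j IH]; first by rewrite /pochhammer big_ord0 !mulr1.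
rewrite doubleS !factS !natrM IH pochhammerS exprS -!(nat1r j.*2.+1) -!nat1r -addnn natrD.
by field.
Qed.

Lemma fact_odd_pochhammer (R : realType) (j : nat) :
  (j.*2.+1)`!%:R = 4 ^+ j * j`!%:R * pochhammer (3 / 2 : R) j.
Proof.
elim: j => [|j IH]; first by rewrite /pochhammer big_ord0 !mulr1.
rewrite doubleS factS natrM factS natrM IH pochhammerS exprS factS natrM.
by rewrite -!(nat1r j.*2.+2) -!(nat1r j.*2.+1) -!nat1r -addnn natrD; field.
Qed.

Lemma continuous_gauss_shift (R : realType) (p x t : R) : 0 < t ->
  {for t, continuous (fun s => s `^ p * expR (- s ^+ 2 - 2 * x * s))}.
Proof.
move=> t0; apply: cvgM; first exact: continuous_powR.
have h : {for t, continuous (fun s : R => - s ^+ 2 - 2 * x * s)}.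
  apply: cvgB; last exact: mulrl_continuous.
  by apply: cvgN; exact: exprn_continuous.
exact: (cvg_comp _ _ h (@continuous_expR _ _)).
Qed.

(** Complete the square at [t = X + 1]. Of the decay [exp (- 2 t)], one half can absorb a power of
    [t] and the other half keeps the integral finite. *)
Lemma gauss_shift_le (R : realType) (X x t : R) : `|x| <= X -> 0 < t ->
  - t ^+ 2 - 2 * x * t <= (X + 1) ^+ 2 - 2 * t.
Proof.
move=> xX t0; have : - x <= X by rewrite (le_trans _ xX)// -normrN ler_norm.
move/(ler_wpM2r (ltW t0)); have := sqr_ge0 (t - (X + 1)); lra.
Qed.

Lemma integrable_gauss_shift (R : realType) (p x : R) : 0 <= p ->
  integrable0y (fun s => s `^ p * expR (- s ^+ 2 - 2 * x * s)).
Proof.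
move=> p0; have [C C0 hC] := @powR_le_expR R p 1 ltr01.
have [] := @integrable0y_dom R (fun s => s `^ p * expR (- s ^+ 2 - 2 * x * s))
  (C * expR ((`|x| + 1) ^+ 2)) 1 ltr01 => //.
  by move=> t; exact: continuous_gauss_shift.
move=> t t0; rewrite ger0_norm ?mulr_ge0 ?powR_ge0 ?expR_ge0//.
have h1 : t `^ p <= C * expR (1 * t) by rewrite hC ?p0 ?lexx.
have h2 : expR (- t ^+ 2 - 2 * x * t) <= expR ((`|x| + 1) ^+ 2 - 2 * t).
  by rewrite ler_expR gauss_shift_le.
apply: (le_trans (ler_pM (powR_ge0 _ _) (expR_ge0 _) h1 h2)).
rewrite -!mulrA -!expRD ler_pM2l// ler_expR; lra.
Qed.

Lemma cvg_exp_series (R : realType) (y : R) :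
  (\sum_(k < n) y ^+ k / k`!%:R) @[n --> \oo] --> expR y.
Proof.
rewrite [X in X @ \oo --> _](_ : _ = series (exp_coeff y)).
  exact: is_cvg_series_exp_coeff.
by apply/funext => n; rewrite /series /= big_mkord.
Qed.

Lemma exp_series_le (R : realType) (y : R) (n : nat) :
  `|\sum_(k < n) y ^+ k / k`!%:R| <= expR `|y|.
Proof.
rewrite (le_trans (ler_norm_sum _ _ _))//.
have -> : \sum_(k < n) `|y ^+ k / k`!%:R| = \sum_(k < n) `|y| ^+ k / k`!%:R.
  by apply: eq_bigr => k _; rewrite normrM normfV normr_nat normrX.
have h := @cvg_exp_series _ `|y|.
rewrite -(cvg_lim _ h)//.
apply: (nondecreasing_cvgn_le _ (cvgP _ h)) => m k mk.
by rewrite -(subnKC mk) big_split_ord/= lerDl; apply: sumr_ge0 => i _; rewrite divr_ge0// exprn_ge0.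
Qed.

Lemma sum_double (V : zmodType) (F : nat -> V) (n : nat) :
  \sum_(k < n.*2) F k = \sum_(j < n) (F j.*2 + F j.*2.+1).
Proof.
elim: n => [|n IH]; first by rewrite !big_ord0.
by rewrite doubleS !big_ord_recr/= IH addrA.
Qed.

(** Expand [exp (- 2 x s)] and integrate termwise: each term is a Gaussian moment, hence a Gamma
    value, and the even and odd terms form the two Kummer series. *)
Lemma hermite_integral (R : realType) (nu x : R) : nu <= - 2 ->
  euler_integral (- nu) * hermite nu x =
  Rint0y (fun s => s `^ (- nu - 1) * expR (- s ^+ 2 - 2 * x * s)).
Proof.
move=> nu2; pose p := - nu - 1; have p0 : 0 <= p by rewrite /p; lra.
have nu0 : 0 < - nu by lra.
pose T k (s : R) := (- (2 * x)) ^+ k / k`!%:R * (s `^ (p + k%:R) * expR (- s ^+ 2)).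
have pk k : 0 <= p + k%:R by rewrite addr_ge0.
have Ti k : integrable0y (T k).
  by have [] := Rint0yZ ((- (2 * x)) ^+ k / k`!%:R) (integrable_gauss_moment (pk k)).
have Tv k : Rint0y (T k) =
    (- (2 * x)) ^+ k / k`!%:R * (euler_integral ((k%:R - nu) / 2) / 2).
  have [_ ->] := Rint0yZ ((- (2 * x)) ^+ k / k`!%:R) (integrable_gauss_moment (pk k)).
  have q1 : 1 <= k%:R - nu by have := ler0n R k; lra.
  rewrite -(Rint0y_gauss_moment q1); congr (_ * _); apply: Rint0y_eq => s _.
  by congr (_ `^ _ * _); rewrite /p; ring.
pose S n s := \sum_(k < n) T k s.
have SE n (s : R) : 0 < s -> S n s =
    s `^ p * expR (- s ^+ 2) * \sum_(k < n) (- (2 * x) * s) ^+ k / k`!%:R.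
  move=> s0; rewrite /S mulr_sumr; apply: eq_bigr => k _.
  rewrite /T powRD ?(gt_eqF s0) ?implybT// powR_mulrn ?(ltW s0)// exprMn; ring.
have SEe (s y : R) : s `^ p * expR (- s ^+ 2 + y) = s `^ p * expR (- s ^+ 2) * expR y.
  by rewrite expRD mulrA.
have lim_S : Rint0y (S n) @[n --> \oo] -->
    Rint0y (fun s => s `^ p * expR (- s ^+ 2 - 2 * x * s)).
  (* The kernel with [- |x|] in place of [x] dominates, as partial sums of the exponential series
     are at most [exp (2 |x| s)]. *)
  apply: (@cvg_Rint0y_dominated R S _ (fun s => s `^ p * expR (- s ^+ 2 - 2 * (- `|x|) * s))).
  - by move=> n; have [] := Rint0y_sum n Ti.
  - exact: integrable_gauss_shift.
  - exact: integrable_gauss_shift.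
  - move=> s s0; rewrite SEe -[- (2 * x * s)]mulNr.
    rewrite [X in X @ \oo --> _](_ : _ = fun n => s `^ p * expR (- s ^+ 2) *
      \sum_(k < n) (- (2 * x) * s) ^+ k / k`!%:R); last by apply/funext => n; exact: SE.
    exact: (cvgM (cvg_cst _) (@cvg_exp_series _ _)).
  - move=> n s s0; rewrite SE// SEe normrM ger0_norm ?mulr_ge0 ?powR_ge0 ?expR_ge0//.
    apply: ler_wpM2l; first by rewrite mulr_ge0 ?powR_ge0 ?expR_ge0.
    apply: (le_trans (exp_series_le _ _)); rewrite ler_expR normrM (gtr0_norm s0).
    by rewrite normrN normrM ger0_norm// mulrN mulNr opprK.
(* Partial sums of even length pair the terms [2 j] and [2 j + 1], one for each Kummer series. *)
have SvE n : Rint0y (S n.*2) = euler_integral (- (nu / 2)) / 2 *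
    series (kummer_term (- (nu / 2)) (1 / 2) (x ^+ 2)) n -
    x * euler_integral ((1 - nu) / 2) * series (kummer_term ((1 - nu) / 2) (3 / 2) (x ^+ 2)) n.
  have [_ ->] := Rint0y_sum n.*2 Ti.
  rewrite (sum_double (fun k => Rint0y (T k))) /series /= !big_mkord !mulr_sumr -sumrB.
  apply: eq_bigr => j _.
  rewrite !Tv fact_even_pochhammer fact_odd_pochhammer.
  have -> : ((j.*2)%:R - nu) / 2 = - (nu / 2) + j%:R by rewrite -addnn natrD; field.
  have -> : ((j.*2.+1)%:R - nu) / 2 = (1 - nu) / 2 + j%:R.
    by rewrite -nat1r -addnn natrD; field.
  rewrite !euler_integralDn; [|lra|lra].
  have xE : (- (2 * x)) ^+ j.*2 = 4 ^+ j * x ^+ 2 ^+ j.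
    by rewrite -mul2n exprM sqrrN -exprMn; congr (_ ^+ _); ring.
  rewrite /kummer_term exprS xE.
  have := @pochhammer_gt0 R (1 / 2) j ltac:(lra).
  have := @pochhammer_gt0 R (3 / 2) j ltac:(lra).
  have : 0 < j`!%:R :> R by rewrite ltr0n fact_gt0.
  have : 0 < 4 ^+ j :> R by rewrite exprn_gt0.
  move: (pochhammer _ _) (pochhammer _ _) (pochhammer _ _) (pochhammer _ _).
  move: (euler_integral _) (euler_integral _) (4 ^+ j) (j`!%:R) (x ^+ 2 ^+ j).
  by move=> E1 E2 w f y p1 p2 p3 p4 w0 f0 p30 p10; field; rewrite !lt0r_neq0.
have lim_S2 : Rint0y (S n.*2) @[n --> \oo] -->
    euler_integral (- (nu / 2)) / 2 * kummerM (- (nu / 2)) (1 / 2) (x ^+ 2) -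
    x * euler_integral ((1 - nu) / 2) * kummerM ((1 - nu) / 2) (3 / 2) (x ^+ 2).
  rewrite (funext SvE).
  apply: cvgB; apply: (cvgM (cvg_cst _)); apply: cvg_kummerM; lra.
have dbl : n.*2 @[n --> \oo] --> \oo.
  move=> P [N _ NP]; exists N => //= n Nn; apply: NP => /=.
  by rewrite (leq_trans Nn)// -addnn leq_addr.
rewrite -/p (cvg_unique _ (cvg_comp _ _ dbl lim_S) lim_S2)//.
have n20 : 0 < - (nu / 2) by lra.
have n120 : 0 < (1 - nu) / 2 by lra.
rewrite /hermite (Gamma_gt0E n20) (Gamma_gt0E n120).
(* At [z = - nu] this turns the two half-argument Gamma values into the prefactor [2 ^ nu sqrt pi]
   of [hermite]. *)
have := euler_integral_duplication nu0.
have -> : - nu / 2 = - (nu / 2) by field.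
have -> : (- nu + 1) / 2 = (1 - nu) / 2 by field.
have -> : 2 `^ (1 - - nu) = 2 * 2 `^ nu :> R.
  by rewrite opprK powRD ?pnatr_eq0 ?implybT// powRr1.
have := euler_integral_gt0 n20; have := euler_integral_gt0 n120.
move: (euler_integral _) (euler_integral _) (euler_integral _) (kummerM _ _ _) (kummerM _ _ _).
move: (2 `^ nu) (Num.sqrt _) => b r G.
move=> A B m2 m1 B0 A0 h.
rewrite [LHS](_ : _ = 2 * b * r * G / 2 * (B^-1 * m1 - 2 * x / A * m2)).
  by rewrite -h; field; rewrite !lt0r_neq0.
by field; rewrite !lt0r_neq0.
Qed.

(** * Charlier polynomials *)

(** The sign in [(- a) ^- k] turns falling factorials of [nu] into rising ones of [- nu], the form
    that Gamma integrals produce. *)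
Lemma charlierE (R : realType) (a : R) (n : nat) (nu : R) :
  charlier a n nu = \sum_(k < n.+1) 'C(n, k)%:R * pochhammer (- nu) k / a ^+ k.
Proof.
rewrite /charlier; apply: eq_bigr => k _.
have -> : pochhammer (- nu) k = (-1) ^+ k * \prod_(i < k) (nu - i%:R).
  rewrite -[in (-1) ^+ k](card_ord k) -prodr_const -big_split /=.
  by apply: eq_bigr => i _; rewrite mulN1r opprB addrC.
have -> : (- a) ^- k = (-1) ^+ k / a ^+ k.
  by rewrite -[in LHS]mulN1r exprMn invfM -signr_odd signrE; case: (odd k) => //=;
    rewrite ?subr0 ?invr1//; congr (_ * _); rewrite (_ : 1 - 1 *+ 2 = -1) ?invrN1//; ring.
have f0 : k`!%:R != 0 :> R by rewrite pnatr_eq0 -lt0n fact_gt0.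
rewrite /gbinom; move: (\prod_(i < k) _) ((-1) ^+ k) (a ^+ k)^-1 => p s b.
by field.
Qed.

(** With [y = - nu], shifting [y] down by 1 and taking the difference weights the [k]-th term by
    [n - k] ([h1]), while shifting it up weights the term by [y + k] ([h2]). The weights add up to
    the constant [n + y]. *)
Lemma charlier_recurrence (R : realType) (a : R) (n : nat) (nu : R) : 0 < a ->
  a * charlier a n (nu + 1) =
  (nu + a - n%:R) * charlier a n nu - nu * charlier a n (nu - 1).
Proof.
move=> a0; rewrite !charlierE.
have -> : - (nu + 1) = - nu - 1 by ring.
have -> : - (nu - 1) = - nu + 1 by ring.
set y := - nu; have -> : nu = - y by rewrite opprK.
have an k : a ^+ k != 0 by rewrite expf_neq0// gt_eqF.
have h1 : a * (\sum_(k < n.+1) 'C(n, k)%:R * pochhammer y k / a ^+ k -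
    \sum_(k < n.+1) 'C(n, k)%:R * pochhammer (y - 1) k / a ^+ k) =
    \sum_(k < n.+1) (n%:R - k%:R) * ('C(n, k)%:R * pochhammer y k / a ^+ k).
  rewrite -sumrB mulr_sumr big_ord_recl big_ord_recr /=.
  (* The first term on the left and the last on the right vanish; the others match after a shift of
     [k], by [(k + 1) C(n, k + 1) = (n - k) C(n, k)]. *)
  rewrite [X in X + _ = _](_ : _ = 0); last first.
    by rewrite /pochhammer !big_ord0 subrr mulr0.
  rewrite [X in _ = _ + X](_ : _ = 0); last by rewrite subrr mul0r.
  rewrite add0r addr0; apply: eq_bigr => k _.
  rewrite /bump leq0n add1n (pochhammerSl (y - 1)) subrK.
  rewrite pochhammerS exprS.
  have := mul_bin_left n k => /(congr1 (fun m : nat => m%:R : R)).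
  rewrite !natrM natrB ?(ltnW (ltn_ord k))// => E.
  rewrite [RHS](_ : _ = ((n%:R - k%:R) * 'C(n, k)%:R) * (pochhammer y k / a ^+ k)); last by ring.
  rewrite -E -nat1r; move: (an k); move: (a ^+ k) => b b0.
  by field; rewrite b0 gt_eqF.
have h2 : y * \sum_(k < n.+1) 'C(n, k)%:R * pochhammer (y + 1) k / a ^+ k =
    \sum_(k < n.+1) (y + k%:R) * ('C(n, k)%:R * pochhammer y k / a ^+ k).
  rewrite mulr_sumr; apply: eq_bigr => k _.
  have := pochhammerSl y k; rewrite pochhammerS => E.
  rewrite [LHS](_ : _ = y * pochhammer (y + 1) k * ('C(n, k)%:R / a ^+ k)); last by ring.
  by rewrite -E; ring.
have h3 : \sum_(k < n.+1) (n%:R - k%:R) * ('C(n, k)%:R * pochhammer y k / a ^+ k) +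
    \sum_(k < n.+1) (y + k%:R) * ('C(n, k)%:R * pochhammer y k / a ^+ k) =
    (n%:R + y) * \sum_(k < n.+1) 'C(n, k)%:R * pochhammer y k / a ^+ k.
  by rewrite -big_split mulr_sumr; apply: eq_bigr => k _ /=; ring.
move: h1 h2 h3; set s1 := \sum_(k < _) _; set s2 := \sum_(k < _) _; set s3 := \sum_(k < _) _.
set s4 := \sum_(k < _) _; set s5 := \sum_(k < _) _.
move=> h1 h2 h3; rewrite -h1 -h2 in h3.
have -> : a * s2 = a * s1 - a * (s1 - s2) by ring.
have -> : a * (s1 - s2) = (n%:R + y) * s1 - y * s4 by rewrite -h3; ring.
ring.
Qed.

(** Binomial expansion of [(1 + t / a) ^ n], where the [k]-th term integrates to
    [Gamma (k - nu) = (- nu)_k Gamma (- nu)]. *)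
Lemma charlier_integral (R : realType) (a : R) (n : nat) (nu : R) : 0 < a -> nu < 0 ->
  integrable0y (fun t => t `^ (- nu - 1) * expR (- t) * (1 + t / a) ^+ n) /\
  euler_integral (- nu) * charlier a n nu =
  Rint0y (fun t => t `^ (- nu - 1) * expR (- t) * (1 + t / a) ^+ n).
Proof.
move=> a0 nu0; have z0 : 0 < - nu by rewrite oppr_gt0.
pose T k (t : R) := 'C(n, k)%:R / a ^+ k * (t `^ (- nu + k%:R - 1) * expR (- t)).
have zk (k : nat) : 0 < - nu + k%:R by rewrite ltr_wpDr.
have Ti k := Rint0yZ ('C(n, k)%:R / a ^+ k) (integrable_gammaD1 (zk k)).1.
have [Si v] := Rint0y_sum n.+1 (fun k => (Ti k).1).
have SE (t : R) : 0 < t -> \sum_(k < n.+1) T k t =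
    t `^ (- nu - 1) * expR (- t) * (1 + t / a) ^+ n.
  move=> t0; rewrite exprDn mulr_sumr; apply: eq_bigr => k _.
  rewrite expr1n mul1r expr_div_n -(@powR_mulrn _ t) ?(ltW t0)// /T.
  have -> : - nu + k%:R - 1 = (- nu - 1) + k%:R by ring.
  rewrite (@powRD _ t) ?(gt_eqF t0) ?implybT// -mulr_natr; ring.
split; first exact: integrable0y_eq SE Si.
rewrite -(Rint0y_eq SE) v charlierE mulr_sumr; apply: eq_bigr => k _.
rewrite /T (Ti k).2 -[Rint0y _]/(euler_integral _).
by rewrite euler_integralDn//; ring.
Qed.

Lemma charlier_degree_bounds (R : realType) (a x : R) : 0 <= charlier_degree a x ->
  a - x * Num.sqrt (2 * a) <= (`|charlier_degree a x|%N)%:R <=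
  a - x * Num.sqrt (2 * a) + 1.
Proof.
rewrite /charlier_degree => d0; rewrite natr_absz ger0_norm//.
have := ceil_itv (a - x * Num.sqrt (2 * a)); rewrite intrD => /andP[h1 h2].
by rewrite h2 -lerBlDr ltW.
Qed.

Lemma scaled_charlier_recurrence (R : realType) (a x nu : R) : 0 < a ->
  scaled_charlier a x (nu + 1) =
  Num.sqrt (2 * a) / a * (nu + a - (`|charlier_degree a x|%N)%:R) * scaled_charlier a x nu
  - 2 * nu * scaled_charlier a x (nu - 1).
Proof.
move=> a0; rewrite /scaled_charlier; set n := `|_|%N; set c := Num.sqrt _.
have a20 : 0 < 2 * a by rewrite mulr_gt0.
have cc : c * c = 2 * a by rewrite -expr2 sqr_sqrtr// ltW.
have c0 : c != 0 by rewrite sqrtr_eq0 -ltNge.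
have cE : c = (2 * a) `^ (2^-1) by rewrite powR12_sqrt// ltW.
have E1 : (2 * a) `^ ((nu + 1) / 2) = (2 * a) `^ (nu / 2) * c.
  by rewrite cE -powRD ?(gt_eqF a20) ?implybT//; congr (_ `^ _); field.
have E2 : (2 * a) `^ (nu / 2) = (2 * a) `^ ((nu - 1) / 2) * c.
  by rewrite cE -powRD ?(gt_eqF a20) ?implybT//; congr (_ `^ _); field.
have := charlier_recurrence n nu a0.
rewrite E1 [X in _ - _ * (X * _)](_ : _ = (2 * a) `^ (nu / 2) / c); last first.
  by rewrite E2 mulfK.
move: (charlier _ _ _) (charlier _ _ _) (charlier _ _ _) (_ `^ _) => w v u p h.
rewrite [LHS](_ : _ = p * c / a * (a * u)); last by field; rewrite gt_eqF.
have -> : p / c = p * c / (2 * a) by rewrite -cc; field.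
by rewrite h; field; rewrite gt_eqF.
Qed.

(** Substitute [t = c s] with [c = sqrt (2 a)]: the resulting power [c ^ (- nu)] cancels the scaling
    [(2 a) ^ (nu / 2) = c ^ nu]. *)
Lemma scaled_charlier_integral (R : realType) (a x nu : R) : 0 < a -> nu < 0 ->
  let h s := s `^ (- nu - 1) * (expR (- (Num.sqrt (2 * a) * s)) *
    (1 + Num.sqrt (2 * a) / a * s) ^+ `|charlier_degree a x|%N) in
  integrable0y h /\ euler_integral (- nu) * scaled_charlier a x nu = Rint0y h.
Proof.
move=> a0 nu0 /=; rewrite /scaled_charlier; set n := `|_|%N; set c := Num.sqrt _.
have a20 : 0 < 2 * a by rewrite mulr_gt0.
have c0 : 0 < c by rewrite sqrtr_gt0.
rewrite mulrCA; have [Gi ->] := charlier_integral n a0 nu0.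
have cE : (2 * a) `^ (nu / 2) = c `^ nu.
  by rewrite /c -(powR12_sqrt (ltW a20)) -powRrM; congr (_ `^ _); rewrite mulrC.
pose G t := t `^ (- nu - 1) * expR (- t) * (1 + t / a) ^+ n.
have dF (t : R) : 0 < t -> is_derive t 1 (fun s : R => c * s) c.
  by move=> _; apply: is_derive_eq; rewrite -[_ *: _]/(_ * _) mulr1 ?scaler0 ?addr0.
have cG (t : R) : 0 < t -> {for t, continuous G}.
  move=> t0; apply: cvgM; first exact: continuous_powR_expRN.
  have h : {for t, continuous (fun s : R => 1 + s / a)}.
    by apply: cvgD; [exact: cvg_cst|exact: mulrr_continuous].
  exact: (cvg_comp _ _ h (@exprn_continuous _ n _)).
have [] := @Rint0y_subst R (fun s => c * s) (fun=> c) G dF.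
- by move=> t _; exact: cvg_cst.
- by move=> t _; exact: ltW.
- by move=> s t _ st; rewrite ltr_pM2l.
- apply: cvg_at_right_filter; rewrite -[X in _ --> X](mulr0 c); exact: mulrl_continuous.
- by apply: gt0_cvgMry => //; exact: cvg_id.
- exact: cG.
- move=> t t0; rewrite !mulr_ge0 ?powR_ge0 ?expR_ge0// exprn_ge0// addr_ge0//.
  by rewrite divr_ge0// ltW.
move=> v /(_ Gi) i.
have e (s : R) : 0 < s -> c `^ nu * (G (c * s) * c) =
    s `^ (- nu - 1) * (expR (- (c * s)) * (1 + c / a * s) ^+ n).
  move=> s0; rewrite /G powRM ?(ltW c0) ?(ltW s0)//.
  have cc : c `^ nu * (c `^ (- nu - 1) * c) = 1.
    have := @powRD _ c (- nu - 1) 1.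
    rewrite (gt_eqF c0) implybT subrK (powRr1 (ltW c0)) => /(_ isT) <-.
    by rewrite -powRD ?(gt_eqF c0) ?implybT// subrr powRr0.
  rewrite [c * s / a]mulrAC -[RHS]mul1r -[X in _ = X * _]cc; ring.
have [j w] := Rint0yZ (c `^ nu) i.
split; first exact: integrable0y_eq e j.
by rewrite -(Rint0y_eq e) w -v cE.
Qed.

Lemma derivable_scaled_charlier (R : realType) (a x nu : R) : 0 < a ->
  derivable (scaled_charlier a x) nu 1.
Proof.
move=> a0; have a20 : 0 < 2 * a by rewrite mulr_gt0.
rewrite /scaled_charlier; set n := `|_|%N.
have -> : (fun nu => (2 * a) `^ (nu / 2) * charlier a n nu) =
    (fun nu => expR (ln (2 * a) / 2 * nu)) * charlier a n.
  by apply/funext => y; rewrite fctE /powR (gt_eqF a20); congr (expR _ * _); ring.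
have dlin (u : R) : derivable (fun y : R => u * y) nu 1.
  by apply/derivable1_diffP; exact: differentiableM.
apply: derivableM.
  by apply: (@ex_derive _ _ _ _ _ _ _ (@is_derive1_comp _ expR (fun y => ln (2 * a) / 2 * y)
    nu _ _ (is_derive_expR _) (derivableP (dlin _)))).
have dpoch k : derivable (fun y : R => pochhammer (- y) k) nu 1.
  elim: k => [|k IH].
    rewrite (_ : (fun y => _) = cst 1); first exact: derivable_cst.
    by apply/funext => y; rewrite /pochhammer big_ord0.
  rewrite (_ : (fun y => _) = (fun y => pochhammer (- y) k) * (fun y => - y + k%:R)).
    apply: derivableM => //.
  by apply/funext => y; rewrite pochhammerS.
have -> : charlier a n = \sum_(k < n.+1) (fun y => 'C(n, k)%:R / a ^+ k * pochhammer (- y) k).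
  by apply/funext => y; rewrite charlierE fct_sumE; apply: eq_bigr => k _; ring.
apply: derivable_sum => k; apply: derivableM => //.
Qed.

(** * The integral kernel *)

Lemma derive_ge0_ge0 (R : realType) (F f : R -> R) (u : R) :
  (forall t : R, 0 <= t -> is_derive t 1 F (f t)) ->
  (forall t : R, 0 <= t -> 0 <= f t) -> F 0 = 0 -> 0 <= u -> 0 <= F u.
Proof.
move=> dF f0 F0 u0.
have [||t tu h] := @MVT_segment R F f 0 u u0.
- by move=> t; rewrite in_itv/= => /andP[/ltW t0 _]; exact: dF.
- by apply: derivable_within_continuous => t; rewrite in_itv/= => /andP[t0 _];
    have [] := dF _ t0.
move: h; rewrite F0 !subr0 => ->; rewrite mulr_ge0// f0//.
by move: tu; rewrite in_itv/= => /andP[].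
Qed.

Lemma is_derive_ln1D (R : realType) (t : R) : 0 <= t ->
  is_derive t 1 (fun u => ln (1 + u)) (1 + t)^-1.
Proof.
move=> t0; have t1 : 0 < 1 + t by rewrite ltr_wpDr.
have h : is_derive t 1 (fun u : R => 1 + u) 1.
  by apply: is_derive_eq; rewrite add0r mulr1.
have := @is_derive1_comp _ (@ln R) (fun u => 1 + u) t _ _ (is_derive1_ln t1) h.
by rewrite mulr1.
Qed.

(** Apart from the second bound, each difference vanishes at 0 and has derivative [t ^ k / (1 + t)]
    with [k = 2, 3, 4]. *)
Lemma ln1D_bounds (R : realType) (u : R) : 0 <= u ->
  [/\ u - u ^+ 2 / 2 <= ln (1 + u), ln (1 + u) <= u,
      ln (1 + u) <= u - u ^+ 2 / 2 + u ^+ 3 / 3 &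
      u - u ^+ 2 / 2 + u ^+ 3 / 3 - u ^+ 4 / 4 <= ln (1 + u)].
Proof.
move=> u0.
have d2 (t : R) : is_derive t 1 (fun u : R => u - u ^+ 2 / 2) (1 - t).
  apply: is_derive_eq; rewrite /GRing.scale /=; by field.
have d3 (t : R) : is_derive t 1 (fun u : R => u ^+ 3 / 3) (t ^+ 2).
  apply: is_derive_eq; rewrite /GRing.scale /=; by field.
have d4 (t : R) : is_derive t 1 (fun u : R => u ^+ 4 / 4) (t ^+ 3).
  apply: is_derive_eq; rewrite /GRing.scale /=; by field.
split.
- rewrite -subr_ge0.
  apply: (@derive_ge0_ge0 R (fun u => ln (1 + u) - (u - u ^+ 2 / 2))
    (fun t => t ^+ 2 / (1 + t)) u _ _ _ u0).
  + move=> t t0; have t1 : 0 < 1 + t by rewrite ltr_wpDr.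
    apply: (is_derive_eq (is_deriveB (is_derive_ln1D t0) (d2 t))).
    by field; rewrite gt_eqF.
  + by move=> t t0; rewrite divr_ge0// ?exprn_ge0// addr_ge0.
  + by rewrite addr0 ln1 expr0n /= mul0r !subr0.
- by apply: le_ln1Dx; rewrite (lt_le_trans _ u0)// ltrN10.
- rewrite -subr_ge0.
  apply: (@derive_ge0_ge0 R (fun u => u - u ^+ 2 / 2 + u ^+ 3 / 3 - ln (1 + u))
    (fun t => t ^+ 3 / (1 + t)) u _ _ _ u0).
  + move=> t t0; have t1 : 0 < 1 + t by rewrite ltr_wpDr.
    apply: (is_derive_eq (is_deriveB (is_deriveD (d2 t) (d3 t)) (is_derive_ln1D t0))).
    by field; rewrite gt_eqF.
  + by move=> t t0; rewrite divr_ge0// ?exprn_ge0// addr_ge0.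
  + by rewrite addr0 ln1 !expr0n /= !mul0r !subr0 addr0.
- rewrite -subr_ge0.
  apply: (@derive_ge0_ge0 R (fun u => ln (1 + u) - (u - u ^+ 2 / 2 + u ^+ 3 / 3 - u ^+ 4 / 4))
    (fun t => t ^+ 4 / (1 + t)) u _ _ _ u0).
  + move=> t t0; have t1 : 0 < 1 + t by rewrite ltr_wpDr.
    apply: (is_derive_eq (is_deriveB (is_derive_ln1D t0)
      (is_deriveB (is_deriveD (d2 t) (d3 t)) (d4 t)))).
    by field; rewrite gt_eqF.
  + by move=> t t0; rewrite divr_ge0// ?exprn_ge0// addr_ge0.
  + by rewrite addr0 ln1 !expr0n /= !mul0r !subr0 addr0 subrr.
Qed.

Lemma expR_sub_le (R : realType) (x y M : R) : x <= M -> y <= M ->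
  `|expR x - expR y| <= `|x - y| * expR M.
Proof.
wlog yx : x y / y <= x => [hw xM yM|xM yM].
  have [|/ltW] := leP y x; first by move/hw; apply.
  by move/hw => /(_ yM xM); rewrite distrC [`|y - x|]distrC.
rewrite !ger0_norm ?subr_ge0 ?ler_expR//.
apply: (@le_trans _ _ ((x - y) * expR x)); last first.
  by rewrite ler_wpM2l ?subr_ge0 ?ler_expR.
have := expR_ge1Dx (y - x); rewrite expRD expRN => h.
have := ler_wpM2r (expR_ge0 x) h.
rewrite -mulrA mulVf ?mulr1 ?gt_eqF ?expR_gt0//; lra.
Qed.

(** Convexity places the remainder between 0 and [(exp x - exp y) (x - y)]; the first factor is
    bounded by [expR_sub_le]. *)
Lemma expR_taylor2_le (R : realType) (x y M : R) : x <= M -> y <= M ->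
  `|expR x - expR y - expR y * (x - y)| <= (x - y) ^+ 2 * expR M.
Proof.
move=> xM yM.
have tangent a b : expR a - expR b - expR b * (a - b) >= 0 :> R.
  have := expR_ge1Dx (a - b); rewrite expRD expRN => h.
  have := ler_wpM2r (expR_ge0 b) h.
  rewrite -mulrA mulVf ?mulr1 ?gt_eqF ?expR_gt0//; lra.
rewrite ger0_norm ?tangent//.
have h : expR x - expR y - expR y * (x - y) <= (expR x - expR y) * (x - y).
  have := tangent y x; lra.
apply: (le_trans h); apply: (le_trans (ler_norm _)); rewrite normrM.
rewrite -real_normK ?num_real// expr2 mulrAC; apply: ler_wpM2r => //.
exact: expR_sub_le.
Qed.

Lemma ln1D_tangent_le (R : realType) (u w : R) : 0 <= u -> 0 <= w ->
  ln (1 + u) <= w + (u - w) / (1 + w).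
Proof.
move=> u0 w0; have u1 : 0 < 1 + u by rewrite ltr_wpDr.
have w1 : 0 < 1 + w by rewrite ltr_wpDr.
have [_ lw _ _] := ln1D_bounds w0.
have e : 1 + (u - w) / (1 + w) = (1 + u) / (1 + w) by field; rewrite gt_eqF.
have := @le_ln1Dx R ((u - w) / (1 + w)).
rewrite e ln_div ?posrE// => h.
have : - 1 < (u - w) / (1 + w) by rewrite -subr_gt0 opprK addrC e divr_gt0.
move/h; move: lw; lra.
Qed.

(* The logarithm of the kernel [exp (- c s) (1 + d s) ^ n] of the scaled
   Charlier integral, where [d = sqrt (2 / a)], so that [a = 2 / d ^ 2],
   [c = 2 / d], and [n = a - c x + th]. *)
Definition log_kernel (R : realType) (d x th s : R) : R :=
  (2 / d ^+ 2 - x * (2 / d) + th) * ln (1 + d * s) - 2 / d * s.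

(** An envelope uniform in [d]. Put [k = 2 X + 3]. The main part is at most [- k (s - k)]: for
    [s <= k] it is nonpositive, and for [s > k] the tangent of the logarithm at [u = k d] gives
    slope [- 2 k / (1 + k d)], at most [- k] as [k d <= 1]. The terms in [x] and [th] cost [2 X s]
    and [s], which leaves [k ^ 2 - 2 s]. *)
Lemma log_kernel_le (R : realType) (d x th X s : R) : 0 < d -> (2 * X + 3) * d <= 1 ->
  `|x| <= X -> 0 <= th <= 1 -> 0 < s ->
  log_kernel d x th s <= (2 * X + 3) ^+ 2 - 2 * s.
Proof.
move=> d0; set k := 2 * X + 3 => kd xX /andP[th0 th1] s0.
have X0 : 0 <= X by rewrite (le_trans _ xX).
have k3 : 3 <= k by rewrite /k lerDr mulr_ge0.
have k0 : 0 <= k by rewrite (le_trans _ k3).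
have d1 : d <= 1 by rewrite (le_trans _ kd)// ler_peMl ?(ltW d0)// (le_trans _ k3)// ler1n.
have u0 : 0 <= d * s by rewrite mulr_ge0 ?(ltW d0) ?(ltW s0).
have w0 : 0 <= k * d by rewrite mulr_ge0 ?(ltW d0).
have [_ Lu _ _] := ln1D_bounds u0.
have Lw := ln1D_tangent_le u0 w0.
have L0 : 0 <= ln (1 + d * s) by rewrite ln_ge0// lerDl.
rewrite /log_kernel; move: (ln _) Lu Lw L0 => L Lu Lw L0.
have v0 : 0 < d^-1 by rewrite invr_gt0.
have hx : - (x * (2 / d)) * L <= 2 * X * s.
  have h1 : - x <= X by rewrite (le_trans _ xX)// -normrN ler_norm.
  apply: (@le_trans _ _ (X * (2 / d) * L)).
    by rewrite -mulNr; apply: ler_wpM2r => //; rewrite ler_wpM2r// mulr_ge0// ltW.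
  rewrite [leRHS](_ : _ = X * (2 / d) * (d * s)); last by field; rewrite gt_eqF.
  by apply: ler_wpM2l => //; rewrite !mulr_ge0// ltW.
have ht : th * L <= s.
  apply: (@le_trans _ _ (1 * (d * s))); first exact: ler_pM.
  by rewrite mul1r ger_pMl.
have ha : 2 / d ^+ 2 * L - 2 / d * s <= - (k * (s - k)).
  have a0 : 0 <= 2 / d ^+ 2 by rewrite divr_ge0// exprn_ge0// ltW.
  have [sk|ks] := leP s k.
    apply: (@le_trans _ _ (2 / d ^+ 2 * (d * s) - 2 / d * s)).
      by rewrite lerD2r ler_wpM2l.
    rewrite [leLHS](_ : _ = 0); last by field; rewrite gt_eqF.
    by rewrite oppr_ge0 mulr_ge0_le0// subr_le0.
  apply: (@le_trans _ _ (2 / d ^+ 2 * (k * d + (d * s - k * d) / (1 + k * d)) - 2 / d * s)).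
    by rewrite lerD2r ler_wpM2l.
  have w1 : 0 < 1 + k * d by rewrite ltr_wpDr.
  rewrite [leLHS](_ : _ = - (k * (s - k)) * (2 / (1 + k * d))); last first.
    by field; rewrite !gt_eqF.
  rewrite !mulNr lerN2 ler_peMr//; first by rewrite mulr_ge0// subr_ge0 ltW.
  by rewrite ler_pdivlMr// mul1r; move: kd; lra.
move: hx ht ha; rewrite /k; lra.
Qed.

(** Three remainders survive: the cubic one of the logarithm times [2 / d ^ 2], the quadratic one
    times [2 x / d], and [th ln (1 + d s)]. Each keeps a factor [d]. *)
Lemma log_kernel_diff_le (R : realType) (d x th X s : R) : 0 < d ->
  `|x| <= X -> 0 <= th <= 1 -> 0 < s ->
  `|log_kernel d x th s - (- s ^+ 2 - 2 * x * s)| <= d * (s ^+ 3 + X * s ^+ 2 + s).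
Proof.
move=> d0 xX /andP[th0 th1] s0.
have X0 : 0 <= X by rewrite (le_trans _ xX).
have u0 : 0 <= d * s by rewrite mulr_ge0 ?(ltW d0) ?(ltW s0).
have [L1 L2 L3 _] := ln1D_bounds u0.
have L0 : 0 <= ln (1 + d * s) by rewrite ln_ge0// lerDl.
rewrite /log_kernel; move: (ln _) L0 L1 L2 L3 => L L0 L1 L2 L3.
have dn : d != 0 by rewrite gt_eqF.
rewrite [X in `|X|](_ : _ = 2 / d ^+ 2 * (L - (d * s - (d * s) ^+ 2 / 2)) +
  x * (2 / d * (d * s - L)) + th * L); last by field.
have h1 : `|2 / d ^+ 2 * (L - (d * s - (d * s) ^+ 2 / 2))| <= d * s ^+ 3.
  have a0 : 0 <= 2 / d ^+ 2 by rewrite divr_ge0// exprn_ge0// ltW.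
  rewrite ger0_norm; last by rewrite mulr_ge0// subr_ge0.
  apply: (@le_trans _ _ (2 / d ^+ 2 * ((d * s) ^+ 3 / 3))).
    by rewrite ler_wpM2l//; move: L3; lra.
  rewrite [leLHS](_ : _ = 2 / 3 * (d * s ^+ 3)); last by field.
  by apply: ler_piMl; [rewrite mulr_ge0// ?exprn_ge0// ltW|lra].
have h2 : `|x * (2 / d * (d * s - L))| <= d * (X * s ^+ 2).
  have a0 : 0 <= 2 / d by rewrite divr_ge0// ltW.
  rewrite normrM [X in _ * X]ger0_norm; last by rewrite mulr_ge0// subr_ge0.
  apply: (@le_trans _ _ (X * (2 / d * ((d * s) ^+ 2 / 2)))).
    apply: ler_pM => //; first by rewrite mulr_ge0// subr_ge0.
    by rewrite ler_wpM2l//; move: L1; lra.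
  by rewrite le_eqVlt; apply/orP; left; apply/eqP; field.
have h3 : `|th * L| <= d * s.
  by rewrite ger0_norm ?mulr_ge0// -[leRHS]mul1r; exact: ler_pM.
apply: (le_trans (ler_normD _ _)).
apply: (le_trans (lerD (ler_normD _ _) (lexx _))).
by move: h1 h2 h3; rewrite !mulrDr; lra.
Qed.

(** The cubic term [2 / 3 d s ^ 3] is the first-order deviation from the Gaussian, from which the
    sharp constant arises. *)
Lemma log_kernel_taylor (R : realType) (d s : R) : 0 < d -> 0 < s ->
  `|log_kernel d 0 0 s - (- s ^+ 2) - 2 / 3 * d * s ^+ 3| <= d ^+ 2 * s ^+ 4.
Proof.
move=> d0 s0.
have u0 : 0 <= d * s by rewrite mulr_ge0 ?(ltW d0) ?(ltW s0).
have [_ _ L3 L4] := ln1D_bounds u0.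
rewrite /log_kernel; move: (ln _) L3 L4 => L L3 L4.
have dn : d != 0 by rewrite gt_eqF.
rewrite [X in `|X|](_ : _ =
  - (2 / d ^+ 2 * (d * s - (d * s) ^+ 2 / 2 + (d * s) ^+ 3 / 3 - L))); last by field.
have a0 : 0 <= 2 / d ^+ 2 by rewrite divr_ge0// exprn_ge0// ltW.
rewrite normrN ger0_norm; last by rewrite mulr_ge0// subr_ge0.
apply: (@le_trans _ _ (2 / d ^+ 2 * ((d * s) ^+ 4 / 4))).
  by rewrite ler_wpM2l//; move: L4; lra.
rewrite [leLHS](_ : _ = 1 / 2 * (d ^+ 2 * s ^+ 4)); last by field.
by apply: ler_piMl; [rewrite mulr_ge0// ?exprn_ge0// ltW|lra].
Qed.

(** * Bounded Lipschitz functions *)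

(** One number serves both as bound and as Lipschitz constant, so sums, products and quotients
    propagate it as a whole and a factor [d] can be carried along. *)
Definition lip_bounded (R : realType) (A B K : R) (f : R -> R) :=
  forall y z : R, A <= y <= B -> A <= z <= B ->
    `|f y| <= K /\ `|f y - f z| <= K * `|y - z|.

Lemma lip_bounded_eq (R : realType) (A B K : R) (f g : R -> R) :
  (forall y, A <= y <= B -> f y = g y) -> lip_bounded A B K f -> lip_bounded A B K g.
Proof. by move=> fg h y z yAB zAB; rewrite -!fg//; exact: h. Qed.

Lemma lip_boundedD (R : realType) (A B K K' : R) (f g : R -> R) :
  lip_bounded A B K f -> lip_bounded A B K' g ->
  lip_bounded A B (K + K') (fun y => f y + g y).
Proof.
move=> hf hg y z yAB zAB; have [f1 f2] := hf y z yAB zAB; have [g1 g2] := hg y z yAB zAB.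
split; first by rewrite (le_trans (ler_normD _ _))// lerD.
have -> : f y + g y - (f z + g z) = (f y - f z) + (g y - g z) by ring.
by rewrite (le_trans (ler_normD _ _))// mulrDl lerD.
Qed.

Lemma lip_boundedM (R : realType) (A B K K' : R) (f g : R -> R) :
  lip_bounded A B K f -> lip_bounded A B K' g ->
  lip_bounded A B (2 * (K * K')) (fun y => f y * g y).
Proof.
move=> hf hg y z yAB zAB; have [f1 f2] := hf y z yAB zAB; have [g1 g2] := hg y z yAB zAB.
have [fz _] := hf z y zAB yAB.
have K0 : 0 <= K by rewrite (le_trans _ f1).
have K'0 : 0 <= K' by rewrite (le_trans _ g1).
split.
  rewrite normrM (le_trans (ler_pM _ _ f1 g1))//.
  by rewrite ler_peMl ?mulr_ge0// ler1n.
have -> : f y * g y - f z * g z = (f y - f z) * g y + f z * (g y - g z) by ring.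
rewrite (le_trans (ler_normD _ _))// !normrM.
have -> : 2 * (K * K') * `|y - z| = K * `|y - z| * K' + K * (K' * `|y - z|) by ring.
by apply: lerD; apply: ler_pM.
Qed.

Lemma lip_bounded_shift (R : realType) (A B K r : R) (f : R -> R) :
  lip_bounded (A + r) (B + r) K f -> lip_bounded A B K (fun y => f (y + r)).
Proof.
move=> hf y z yAB zAB; have [] := hf (y + r) (z + r); rewrite ?lerD2r//.
by move=> h1; rewrite opprD addrACA subrr addr0.
Qed.

(** The number [|A| + |B| + 1] bounds [|y|] on the interval and is at least 1, so it also covers the
    slope. *)
Lemma lip_bounded_affine (R : realType) (A B u v U V : R) : `|u| <= U -> `|v| <= V ->
  lip_bounded A B (U + V * (`|A| + `|B| + 1)) (fun y => u + v * y).
Proof.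
move=> uU vV y z yAB zAB.
have yb : `|y| <= `|A| + `|B| + 1.
  move/andP: yAB => [Ay yB].
  have := ler_norm B; have := ler_norm (- A); rewrite normrN => h1 h2.
  have := normr_ge0 A; have := normr_ge0 B => h3 h4.
  by rewrite ler_norml; apply/andP; split; lra.
have U0 : 0 <= U by rewrite (le_trans _ uU).
have V0 : 0 <= V by rewrite (le_trans _ vV).
split.
  by rewrite (le_trans (ler_normD _ _))// normrM lerD// ler_pM.
have -> : u + v * y - (u + v * z) = v * (y - z) by ring.
rewrite normrM; apply: ler_wpM2r => //; rewrite (le_trans vV)//.
rewrite -[leLHS]add0r lerD// ler_peMr// lerDr addr_ge0//.
Qed.

Lemma lip_bounded_div (R : realType) (A B K C : R) (f g : R -> R) :
  (forall y, A <= y <= B -> 1 <= g y) ->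
  lip_bounded A B K f -> lip_bounded A B C g ->
  lip_bounded A B (K * (1 + C)) (fun y => f y / g y).
Proof.
move=> g1 hf hg y z yAB zAB; have [f1 f2] := hf y z yAB zAB; have [c1 c2] := hg y z yAB zAB.
have [fz _] := hf z y zAB yAB.
have K0 : 0 <= K by rewrite (le_trans _ f1).
have C0 : 0 <= C by rewrite (le_trans _ c1).
have gy := g1 _ yAB; have gz := g1 _ zAB.
have gy0 : 0 < g y by rewrite (lt_le_trans _ gy).
have gz0 : 0 < g z by rewrite (lt_le_trans _ gz).
have iy : `|(g y)^-1| <= 1 by rewrite ger0_norm ?invf_le1// invr_ge0 ltW.
have iz : `|(g z)^-1| <= 1 by rewrite ger0_norm ?invf_le1// invr_ge0 ltW.
split.
  rewrite normrM (le_trans (ler_pM _ _ f1 iy))// ler_wpM2l// lerDl//.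
have -> : f y / g y - f z / g z =
    (f y - f z) * (g y)^-1 + f z * ((g y - g z) * (- ((g y)^-1 * (g z)^-1))).
  by field; rewrite !gt_eqF.
rewrite (le_trans (ler_normD _ _))// !normrM normrN normrM.
have -> : K * (1 + C) * `|y - z| = K * `|y - z| * 1 + K * (C * `|y - z| * (1 * 1)) by ring.
apply: lerD; apply: ler_pM => //; rewrite ?mulr_ge0//.
by apply: ler_pM => //; rewrite ?mulr_ge0//; apply: ler_pM.
Qed.

(** The derivative in the exponent is [s ^ p ln s]. For [s >= 1], [ln s < s] raises the exponent to
    [P + 1]; for [s < 1], [p >= 1] gives [s |ln s| <= 1]. *)
Lemma powR_lipschitz (R : realType) (P p q s : R) :
  1 <= p <= P -> 1 <= q <= P -> 0 < s ->
  `|s `^ p - s `^ q| <= `|p - q| * (1 + s `^ (P + 1)).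
Proof.
move=> /andP[p1 pP] /andP[q1 qP] s0.
rewrite /powR gt_eqF//; have [s1|s1] := leP 1 s.
  have l0 : 0 <= ln s by rewrite ln_ge0.
  have := @expR_sub_le R (p * ln s) (q * ln s) (P * ln s).
  rewrite !ler_wpM2r// => /(_ isT isT) h; rewrite (le_trans h)//.
  rewrite -mulrBl normrM -mulrA ler_wpM2l// (ger0_norm l0).
  apply: (@le_trans _ _ (s * expR (P * ln s))).
    by rewrite ler_wpM2r ?expR_ge0// ltW// ln_sublinear.
  by rewrite mulrDl mul1r expRD lnK// mulrC lerDr.
have l0 : ln s <= 0 by rewrite ln_le0// ltW.
have := @expR_sub_le R (p * ln s) (q * ln s) (1 * ln s).
rewrite !ler_wnM2r// => /(_ isT isT) h; rewrite (le_trans h)//.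
rewrite -mulrBl normrM -mulrA ler_wpM2l// (ler0_norm l0) mul1r lnK ?posrE//.
apply: (@le_trans _ _ 1); last by rewrite lerDl expR_ge0.
rewrite -lnV ?posrE// (@le_trans _ _ (s^-1 * s))//.
  by rewrite ler_wpM2r ?(ltW s0)// ltW// ln_sublinear// invr_gt0.
by rewrite mulVf ?gt_eqF.
Qed.

(** The estimate is linear in [K], with [C] chosen before [f]: an envelope of size [O(d)] yields
    moments of size and Lipschitz constant [O(d)]. *)
Lemma lip_bounded_moment (R : realType) (P : R) : 1 <= P ->
  exists2 C : R, 0 < C & forall (K : R) (f : R -> R),
    (forall s : R, 0 < s -> {for s, continuous f}) ->
    (forall s : R, 0 < s -> `|f s| <= K * expR (- s)) ->
    (forall p, 1 <= p <= P -> integrable0y (fun s => s `^ p * f s)) /\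
    lip_bounded 1 P (C * K) (fun p => Rint0y (fun s => s `^ p * f s)).
Proof.
move=> P1; have p20 : 0 < 2^-1 :> R by rewrite invr_gt0.
have [C C0 hC] := powR_le_expR (P + 1) p20.
(* One factor 2 is the integral of [exp (- s / 2)], the other comes from
   [1 + s ^ (P + 1) <= 2 C exp (s / 2)]. *)
exists (4 * C) => [|K f cf fK]; first by rewrite mulr_gt0.
have K0 : 0 <= K.
  by have := le_trans (normr_ge0 _) (fK 1 ltr01); rewrite pmulr_lge0 ?expR_gt0.
have eE s : expR (2^-1 * s) * expR (- s) = expR (- (2^-1 * s)) :> R.
  by rewrite -expRD; congr expR; field.
have cp p (s : R) : 0 < s -> {for s, continuous (fun s => s `^ p * f s)}.
  by move=> s0; apply: cvgM; [exact: continuous_powR|exact: cf].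
have dom p (s : R) : 1 <= p <= P -> 0 < s ->
    `|s `^ p * f s| <= C * K * expR (- (2^-1 * s)).
  move=> /andP[p1 pP] s0; rewrite normrM (ger0_norm (powR_ge0 _ _)) -eE.
  have -> : C * K * (expR (2^-1 * s) * expR (- s)) =
    C * expR (2^-1 * s) * (K * expR (- s)) by ring.
  apply: ler_pM => //; [exact: powR_ge0|apply: hC => //; lra|exact: fK].
have ip p : 1 <= p <= P -> integrable0y (fun s => s `^ p * f s).
  by move=> hp; have [] := integrable0y_dom p20 (cp p) (fun s => dom p s hp).
split=> // p q hp hq; have CK : 0 <= C * K by rewrite mulr_ge0// ltW.
split.
  have [_] := integrable0y_dom p20 (cp p) (fun s => dom p s hp).
  move/le_trans; apply; rewrite invrK; lra.
have [_ <-] := Rint0yB (ip _ hp) (ip _ hq).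
have [] := @integrable0y_dom R (fun s => s `^ p * f s - s `^ q * f s)
  (2 * C * K * `|p - q|) 2^-1 p20.
- by move=> s s0; apply: cvgB; exact: cp.
- move=> s s0; rewrite -mulrBl normrM -eE.
  have -> : 2 * C * K * `|p - q| * (expR (2^-1 * s) * expR (- s)) =
    (`|p - q| * (2 * C * expR (2^-1 * s))) * (K * expR (- s)) by ring.
  apply: ler_pM => //; last exact: fK.
  apply: (le_trans (powR_lipschitz hp hq s0)); apply: ler_wpM2l => //.
  have h1 := hC 0 s; have h2 := hC (P + 1) s.
  rewrite powRr0 in h1; have := h1 _ s0; have := h2 _ s0.
  by move=> /(_ ltac:(lra)) a1 /(_ ltac:(lra)) a2; move: a1 a2; lra.
- by move=> _ h; apply: (le_trans h); rewrite invrK; lra.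
Qed.

(** * Comparison for negative indices *)

Lemma lip_bounded_reflect (R : realType) (A K : R) (g : R -> R) :
  lip_bounded 1 (- A - 1) K g -> lip_bounded A (- 2) K (fun nu => g (- nu - 1)).
Proof.
move=> hg y z /andP[Ay yB] /andP[Az zB].
have [||h1 h2] := hg (- y - 1) (- z - 1); [by apply/andP; split; lra..|].
split=> //; rewrite (le_trans h2)//.
have -> : - y - 1 - (- z - 1) = - (y - z) by ring.
by rewrite normrN lexx.
Qed.

Lemma expR_pow_le (R : realType) (n : nat) (s : R) : 0 <= s ->
  s ^+ n.+1 <= (n.+1)`!%:R * expR s.
Proof.
move=> s0; have := expR_ge1Dxn n s0 => h.
rewrite -ler_pdivrMl ?ltr0n ?fact_gt0// mulrC (le_trans _ h)// lerDr//.
Qed.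

Lemma cubic_le_expR (R : realType) (X s : R) : 0 <= X -> 0 <= s ->
  s ^+ 3 + X * s ^+ 2 + s <= (7 + 2 * X) * expR s.
Proof.
move=> X0 s0; have h1 := expR_pow_le 0 s0; have h2 := expR_pow_le 1 s0.
have h3 := expR_pow_le 2 s0.
have := ler_wpM2l X0 h2.
move: h1 h2 h3; rewrite expr1 !factS fact0 !muln1 => h1 h2 h3 h4; lra.
Qed.

Lemma continuous_log_kernel (R : realType) (d x th t : R) : 0 < d -> 0 < t ->
  {for t, continuous (log_kernel d x th)}.
Proof.
move=> d0 t0; apply: cvgB; last exact: mulrl_continuous.
apply: cvgM; first exact: cvg_cst.
have h : {for t, continuous (fun s : R => 1 + d * s)}.
  by apply: cvgD; [exact: cvg_cst|exact: mulrl_continuous].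
have p : 0 < 1 + d * t by rewrite ltr_wpDr// mulr_ge0// ltW.
exact: (cvg_comp _ _ h (continuous_ln p)).
Qed.

(** Both exponents lie below [(2 X + 3) ^ 2 - 2 s]. The polynomial bound on their difference costs a
    factor [exp s], so [exp (- s)] remains. *)
Lemma kernel_diff_le (R : realType) (d x th X s : R) : 0 < d -> (2 * X + 3) * d <= 1 ->
  `|x| <= X -> 0 <= th <= 1 -> 0 < s ->
  `|expR (log_kernel d x th s) - expR (- s ^+ 2 - 2 * x * s)| <=
  d * ((7 + 2 * X) * expR ((2 * X + 3) ^+ 2)) * expR (- s).
Proof.
move=> d0 kd xX th01 s0; have X0 : 0 <= X by rewrite (le_trans _ xX).
have h1 := log_kernel_le d0 kd xX th01 s0.
have h2 : - s ^+ 2 - 2 * x * s <= (2 * X + 3) ^+ 2 - 2 * s.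
  apply: (le_trans (gauss_shift_le xX s0)); rewrite lerD2r ler_pXn2r// ?nnegrE; lra.
apply: (le_trans (expR_sub_le h1 h2)).
have h3 := log_kernel_diff_le d0 xX th01 s0.
have h4 : `|log_kernel d x th s - (- s ^+ 2 - 2 * x * s)| <= d * ((7 + 2 * X) * expR s).
  by rewrite (le_trans h3)// ler_wpM2l// ?(ltW d0)// cubic_le_expR// ltW.
apply: (le_trans (ler_wpM2r (expR_ge0 _) h4)).
rewrite le_eqVlt; apply/orP; left; apply/eqP.
have -> : (2 * X + 3) ^+ 2 - 2 * s = (2 * X + 3) ^+ 2 + (- s + - s) by ring.
rewrite !expRD expRN; field; exact/lt0r_neq0/expR_gt0.
Qed.

Lemma gauss_shift_expR_le (R : realType) (x X s : R) : `|x| <= X -> 0 < s ->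
  `|expR (- s ^+ 2 - 2 * x * s)| <= expR ((X + 1) ^+ 2) * expR (- s).
Proof.
move=> xX s0; rewrite ger0_norm ?expR_ge0// -expRD ler_expR.
by apply: (le_trans (gauss_shift_le xX s0)); lra.
Qed.

Lemma lip_bounded_gamma (R : realType) (A : R) : A <= - 2 ->
  exists C : R, lip_bounded A (- 2) C (fun nu => euler_integral (- nu)).
Proof.
move=> A2; have P1 : 1 <= - A - 1 by lra.
have [C C0 hC] := lip_bounded_moment P1.
have [||_ h] := hC 1 (fun s => expR (- s)).
- move=> t _; apply: (@continuous_comp _ _ _ -%R expR); first exact: opp_continuous.
  exact: continuous_expR.
- by move=> s _; rewrite mul1r ger0_norm ?expR_ge0.
exists (C * 1); exact: (lip_bounded_reflect h).
Qed.

Lemma lip_bounded_hermite_base (R : realType) (A X : R) : A <= - 2 ->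
  exists C : R, forall x, `|x| <= X -> lip_bounded A (- 2) C (fun nu => hermite nu x).
Proof.
move=> A2; have P1 : 1 <= - A - 1 by lra.
have [C C0 hC] := lip_bounded_moment P1; have [G hG] := lip_bounded_gamma A2.
exists (C * expR ((X + 1) ^+ 2) * (1 + G)) => x xX.
have [||_ h] := hC (expR ((X + 1) ^+ 2)) (fun s => expR (- s ^+ 2 - 2 * x * s)).
- move=> t t0.
  have h : {for t, continuous (fun s : R => - s ^+ 2 - 2 * x * s)}.
    apply: cvgB; last exact: mulrl_continuous.
    by apply: cvgN; exact: exprn_continuous.
  exact: (cvg_comp _ _ h (@continuous_expR _ _)).
- by move=> s s0; exact: gauss_shift_expR_le.
have G1 nu : A <= nu <= - 2 -> 1 <= euler_integral (- nu).
  by move=> hnu; apply: euler_integral_ge1; lra.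
have := lip_bounded_div G1 (lip_bounded_reflect h) hG.
apply: lip_bounded_eq => nu hnu; have nu2 : nu <= - 2 by lra.
rewrite -hermite_integral// mulrAC divff ?mul1r//.
by rewrite lt0r_neq0// (lt_le_trans ltr01)// G1.
Qed.

(** Translation between [a], [c] and the parameter [d = c / a] of [log_kernel]; the last identity
    converts [O(d)] into [O(1 / sqrt a)]. *)
Lemma charlier_scale (R : realType) (a : R) : 0 < a ->
  let c := Num.sqrt (2 * a) in
  [/\ 0 < c / a, 2 / (c / a) ^+ 2 = a, 2 / (c / a) = c &
      c / a = Num.sqrt 2 / Num.sqrt a].
Proof.
move=> a0 c; have a20 : 0 < 2 * a by rewrite mulr_gt0.
have cc : c ^+ 2 = 2 * a by rewrite sqr_sqrtr// ltW.
have c0 : 0 < c by rewrite sqrtr_gt0.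
split.
- by rewrite divr_gt0.
- by rewrite expr_div_n cc; field; rewrite gt_eqF.
- have -> : 2 / (c / a) = 2 * a / c by field; rewrite !gt_eqF.
  by rewrite -cc expr2 mulfK// gt_eqF.
- have s0 : 0 < Num.sqrt a by rewrite sqrtr_gt0.
  rewrite /c sqrtrM// -[X in _ / X = _](sqr_sqrtr (ltW a0)).
  by field; rewrite gt_eqF.
Qed.

Lemma scaled_charlier_kernel (R : realType) (a x s : R) : 0 < a -> 0 < s ->
  let c := Num.sqrt (2 * a) in let n := `|charlier_degree a x|%N in
  expR (- (c * s)) * (1 + c / a * s) ^+ n =
  expR (log_kernel (c / a) x (n%:R - (a - x * c)) s).
Proof.
move=> a0 s0 c n; have [d0 dE1 dE2 _] := charlier_scale a0.
rewrite -/c in d0 dE1 dE2.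
have u0 : 0 < 1 + c / a * s by rewrite ltr_wpDr// mulr_ge0// ltW.
rewrite /log_kernel dE1 dE2.
have -> : a - x * c + (n%:R - (a - x * c)) = n%:R by ring.
by rewrite expRD mulrC expRM_natl lnK.
Qed.

Lemma lip_bounded_diff_base (R : realType) (A X : R) : A <= - 2 ->
  exists C : R, forall a x, 0 < a -> (2 * X + 3) * (Num.sqrt (2 * a) / a) <= 1 ->
    `|x| <= X -> 0 <= charlier_degree a x ->
    lip_bounded A (- 2) (C * (Num.sqrt (2 * a) / a))
      (fun nu => scaled_charlier a x nu - hermite nu x).
Proof.
move=> A2; have P1 : 1 <= - A - 1 by lra.
have [C C0 hC] := lip_bounded_moment P1; have [G hG] := lip_bounded_gamma A2.
exists (C * ((7 + 2 * X) * expR ((2 * X + 3) ^+ 2)) * (1 + G)) => a x a0 kd xX dx.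
have [d0 _ _ _] := charlier_scale a0.
have := charlier_degree_bounds dx; set n := `|_|%N => nb.
set c := Num.sqrt (2 * a) in kd d0 nb *.
have th01 : 0 <= n%:R - (a - x * c) <= 1 by lra.
have [||_ h] := hC (c / a * ((7 + 2 * X) * expR ((2 * X + 3) ^+ 2)))
  (fun s => expR (log_kernel (c / a) x (n%:R - (a - x * c)) s) -
            expR (- s ^+ 2 - 2 * x * s)).
- move=> t t0.
  have h : {for t, continuous (fun s : R => - s ^+ 2 - 2 * x * s)}.
    apply: cvgB; last exact: mulrl_continuous.
    by apply: cvgN; exact: exprn_continuous.
  apply: cvgB.
    exact: (cvg_comp _ _ (continuous_log_kernel d0 t0) (@continuous_expR _ _)).
  exact: (cvg_comp _ _ h (@continuous_expR _ _)).
- by move=> s s0; exact: kernel_diff_le.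
have G1 nu : A <= nu <= - 2 -> 1 <= euler_integral (- nu).
  by move=> hnu; apply: euler_integral_ge1; lra.
have := lip_bounded_div G1 (lip_bounded_reflect h) hG.
rewrite [X in lip_bounded _ _ X _ -> _](_ : _ =
  C * ((7 + 2 * X) * expR ((2 * X + 3) ^+ 2)) * (1 + G) * (c / a)); last by ring.
apply: lip_bounded_eq => nu hnu; have nu2 : nu <= - 2 by lra.
have nu0 : nu < 0 by lra.
have [i1 v1] := scaled_charlier_integral x a0 nu0.
have i2 := @integrable_gauss_shift R (- nu - 1) x ltac:(lra).
have [_ v] := Rint0yB i1 i2.
rewrite -v1 -hermite_integral// -mulrBr in v.
rewrite [X in X / _](_ : _ = euler_integral (- nu) * (scaled_charlier a x nu - hermite nu x)).
  by rewrite mulrAC divff ?mul1r// lt0r_neq0// (lt_le_trans ltr01)// G1.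
rewrite -v; apply: Rint0y_eq => s s0.
by rewrite mulrBr -/c -/n (scaled_charlier_kernel x a0 s0).
Qed.

(** * Comparison on bounded intervals *)

Lemma lip_boundedZ (R : realType) (A B K d : R) (f : R -> R) : 0 <= d ->
  lip_bounded A B K f -> lip_bounded A B (d * K) (fun y => d * f y).
Proof.
move=> d0 hf y z yAB zAB; have [f1 f2] := hf y z yAB zAB.
by rewrite -mulrBr !normrM (ger0_norm d0) -mulrA !ler_wpM2l.
Qed.

Lemma lip_boundedW (R : realType) (A B A' B' K : R) (f : R -> R) :
  A' <= A -> B <= B' -> lip_bounded A' B' K f -> lip_bounded A B K f.
Proof.
move=> AA BB hf y z /andP[Ay yB] /andP[Az zB].
by apply: hf; apply/andP; split; rewrite ?(le_trans AA)// (le_trans _ BB).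
Qed.

(** Each use of the recurrence gains 1 at the right end and reads values at [nu - 2], so the
    induction runs over all left ends [A]. *)
Lemma lip_bounded_hermite_nat (R : realType) (X : R) (n : nat) (A : R) : A <= - 2 ->
  exists C : R, forall x, `|x| <= X ->
    lip_bounded A (- 2 + n%:R) C (fun nu => hermite nu x).
Proof.
elim: n A => [|n IH] A A2; first by rewrite addr0; exact: lip_bounded_hermite_base.
have [C hC] := IH (A - 2) ltac:(lra).
set B := - 2 + n%:R in hC; pose D := 2 + 2 * (`|A| + `|B + 1| + 1).
exists (2 * X * C + 2 * (D * C)) => x xX.
have -> : - 2 + n.+1%:R = B + 1 by rewrite /B -[n.+1%:R]natr1 addrA.
have h1 : lip_bounded A (B + 1) C (fun nu => hermite (nu - 1) x).
  apply: (@lip_bounded_shift _ _ _ _ (- 1) (fun nu => hermite nu x)).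
  by apply: lip_boundedW (hC x xX); lra.
have h2 : lip_bounded A (B + 1) C (fun nu => hermite (nu - 2) x).
  apply: (@lip_bounded_shift _ _ _ _ (- 2) (fun nu => hermite nu x)).
  by apply: lip_boundedW (hC x xX); lra.
have h3 : lip_bounded A (B + 1) D (fun nu => 2 + (- 2) * nu).
  by apply: lip_bounded_affine; rewrite ?normrN normr_nat.
have X0 : 0 <= X by rewrite (le_trans _ xX).
have h4 : lip_bounded A (B + 1) (2 * X * C) (fun nu => 2 * x * hermite (nu - 1) x).
  move=> y z yAB zAB; have [f1 f2] := h1 y z yAB zAB.
  have x2 : `|2 * x| <= 2 * X by rewrite normrM normr_nat ler_wpM2l.
  by rewrite -mulrBr normrM (normrM (2 * x)) -[2 * X * C * _]mulrA; split; apply: ler_pM.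
apply: lip_bounded_eq (lip_boundedD h4 (lip_boundedM h3 h2)) => nu _.
have := hermite_recurrence (nu - 1) x; rewrite subrK => ->.
have -> : nu - 1 - 1 = nu - 2 by ring.
ring.
Qed.

(** Subtracting the recurrences expresses the new difference through the two previous ones, with
    bounded coefficients, plus [d] times an affine function times [H (nu - 1)]. Every term is
    [O(d)]. *)
Lemma lip_bounded_diff_nat (R : realType) (X : R) (n : nat) (A : R) : A <= - 2 ->
  exists C : R, forall a x, 0 < a -> (2 * X + 3) * (Num.sqrt (2 * a) / a) <= 1 ->
    `|x| <= X -> 0 <= charlier_degree a x ->
    lip_bounded A (- 2 + n%:R) (C * (Num.sqrt (2 * a) / a))
      (fun nu => scaled_charlier a x nu - hermite nu x).
Proof.
elim: n A => [|n IH] A A2; first by rewrite addr0; exact: lip_bounded_diff_base.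
have [C hC] := IH (A - 2) ltac:(lra).
have [H hH] := @lip_bounded_hermite_nat R X n (A - 2) ltac:(lra).
set B := - 2 + n%:R in hC hH; pose D := `|A| + `|B + 1| + 1.
exists (2 * ((2 * X + 2 + 1 * D) * C) + (2 * ((2 + 1 * D) * H) + 2 * ((2 + 2 * D) * C))).
move=> a x a0 kd xX dx.
have [d0 _ dc _] := charlier_scale a0.
have nb := charlier_degree_bounds dx; have hD := hC a x a0 kd xX dx; move: hD dc d0 kd.
have rec := fun nu => scaled_charlier_recurrence x nu a0; move: rec nb.
set m := `|_|%N; set c := Num.sqrt (2 * a); set d := c / a => rec nb hD dc d0 kd.
pose th := m%:R - (a - x * c).
have th01 : 0 <= th <= 1 by rewrite /th; lra.
have X0 : 0 <= X by rewrite (le_trans _ xX).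
have d1 : d <= 1 by rewrite (le_trans _ kd)// ler_peMl ?(ltW d0)//; lra.
(* The choice of the degree enters here: rounding up costs only [d th]. *)
have ad : d * (a - m%:R) = 2 * x - d * th.
  by rewrite /th -dc; field; rewrite gt_eqF.
have -> : - 2 + n.+1%:R = B + 1 by rewrite /B -[n.+1%:R]natr1 addrA.
have h1 : lip_bounded A (B + 1) (C * d)
    (fun nu => scaled_charlier a x (nu - 1) - hermite (nu - 1) x).
  apply: (@lip_bounded_shift _ _ _ _ (- 1) (fun nu => scaled_charlier a x nu - hermite nu x)).
  by apply: lip_boundedW hD; lra.
have h2 : lip_bounded A (B + 1) (C * d)
    (fun nu => scaled_charlier a x (nu - 2) - hermite (nu - 2) x).
  apply: (@lip_bounded_shift _ _ _ _ (- 2) (fun nu => scaled_charlier a x nu - hermite nu x)).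
  by apply: lip_boundedW hD; lra.
have h3 : lip_bounded A (B + 1) H (fun nu => hermite (nu - 1) x).
  apply: (@lip_bounded_shift _ _ _ _ (- 1) (fun nu => hermite nu x)).
  by apply: lip_boundedW (hH x xX); lra.
have a1 : lip_bounded A (B + 1) (2 * X + 2 + 1 * D) (fun nu => 2 * x - d * (1 + th) + d * nu).
  apply: lip_bounded_affine; last by rewrite ger0_norm// ltW.
  apply: (le_trans (ler_normB _ _)); apply: lerD.
    by rewrite normrM normr_nat ler_wpM2l.
  rewrite ger0_norm; last by rewrite mulr_ge0 ?(ltW d0)//; lra.
  by rewrite -[leRHS]mul1r; apply: ler_pM; [exact: ltW| |exact: d1|]; lra.
have a2 : lip_bounded A (B + 1) (2 + 1 * D) (fun nu => - (1 + th) + 1 * nu).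
  by apply: lip_bounded_affine; rewrite ?normr1// normrN ger0_norm; lra.
have a3 : lip_bounded A (B + 1) (2 + 2 * D) (fun nu => 2 + (- 2) * nu).
  by apply: lip_bounded_affine; rewrite ?normrN normr_nat.
have h := lip_boundedD (lip_boundedM a1 h1)
  (lip_boundedD (lip_boundedZ (ltW d0) (lip_boundedM a2 h3)) (lip_boundedM a3 h2)).
rewrite [X in lip_bounded _ _ X _](_ : _ = 2 * ((2 * X + 2 + 1 * D) * (C * d)) +
   (d * (2 * ((2 + 1 * D) * H)) + 2 * ((2 + 2 * D) * (C * d)))); last by ring.
apply: lip_bounded_eq h => nu _.
have := rec (nu - 1); rewrite subrK => ->.
have := hermite_recurrence (nu - 1) x; rewrite subrK => ->.
have -> : nu - 1 - 1 = nu - 2 by ring.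
have -> : d * (nu - 1 + a - m%:R) = 2 * x - d * th + d * (nu - 1) by rewrite -ad; ring.
move: (scaled_charlier _ _ _) (scaled_charlier _ _ _) (hermite _ _) (hermite _ _) => u v w y.
ring.
Qed.

Lemma lip_bounded_diff (R : realType) (A B X : R) :
  exists C : R, forall a x, 0 < a -> (2 * X + 3) * (Num.sqrt (2 * a) / a) <= 1 ->
    `|x| <= X -> 0 <= charlier_degree a x ->
    lip_bounded A B (C * (Num.sqrt (2 * a) / a))
      (fun nu => scaled_charlier a x nu - hermite nu x).
Proof.
have A2 : Num.min A (- 2) <= - 2 :> R by rewrite ge_min lexx orbT.
have Bn : B <= - 2 + (Num.truncn `|B + 2|).+1%:R.
  rewrite -lerBlDl opprK (le_trans (ler_norm _))// ltW//; exact: truncnS_gt.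
have [C hC] := lip_bounded_diff_nat X (Num.truncn `|B + 2|).+1 A2.
exists C => a x a0 kd xX dx.
by apply: lip_boundedW (hC a x a0 kd xX dx) => //; rewrite ge_min lexx.
Qed.

(** * From Lipschitz bounds to derivatives *)

Lemma charlier_scale_small (R : realType) (e : R) : 0 < e ->
  exists2 a0 : R, 0 < a0 & forall a, a0 <= a -> Num.sqrt (2 * a) / a <= e.
Proof.
move=> e0; have s2 : 0 < Num.sqrt 2 :> R by rewrite sqrtr_gt0.
have t0 : 0 < Num.sqrt 2 / e by rewrite divr_gt0.
exists ((Num.sqrt 2 / e) ^+ 2) => [|a ha]; first by rewrite exprn_gt0.
have a0 : 0 < a by rewrite (lt_le_trans _ ha)// exprn_gt0.
have [_ _ _ ->] := charlier_scale a0.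
have sa : Num.sqrt 2 / e <= Num.sqrt a.
  by rewrite -[leLHS](ger0_norm (ltW t0)) -sqrtr_sqr ler_wsqrtr.
have sa0 : 0 < Num.sqrt a by rewrite sqrtr_gt0.
by rewrite ler_pdivrMr// mulrC -ler_pdivrMr.
Qed.

Lemma charlier_degree_ge0 (R : realType) (a x X : R) : 0 < a ->
  (2 * X + 3) * (Num.sqrt (2 * a) / a) <= 1 -> `|x| <= X -> 0 <= charlier_degree a x.
Proof.
move=> a0 kd xX; rewrite /charlier_degree ceil_ge0 (lt_le_trans (ltrN10 _))// subr_ge0.
have X0 : 0 <= X by rewrite (le_trans _ xX).
have d0 : 0 <= Num.sqrt (2 * a) / a by rewrite divr_ge0 ?sqrtr_ge0// ltW.
have xd : x * (Num.sqrt (2 * a) / a) <= 1.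
  apply: le_trans kd; apply: ler_wpM2r => //.
  by have := le_trans (ler_norm x) xX; lra.
by rewrite mulrA ler_pdivrMr// mul1r in xd.
Qed.

(** If [g - H] has a Lipschitz constant [e / 2] around [nu], the difference quotients of [H] stay
    within [e / 2] of those of [g], which converge; hence they are Cauchy. *)
Lemma derivable_approx (R : realType) (H : R -> R) (nu : R) :
  (forall e, 0 < e -> exists2 g : R -> R, derivable g nu 1 &
    forall h, `|h| <= 1 -> `|(g (h + nu) - H (h + nu)) - (g nu - H nu)| <= e * `|h|) ->
  derivable H nu 1.
Proof.
move=> hg; apply/cauchy_cvgP/cauchy_exP => e e0.
have [g dg gH] := hg (e / 2) ltac:(by rewrite divr_gt0).
exists ('D_1 g nu).
have dgl : h^-1 *: (g (h *: 1 + nu) - g nu) @[h --> 0^'] --> 'D_1 g nu := dg.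
have n1 : \forall h \near 0^', `|'D_1 g nu - h^-1 *: (g (h *: 1 + nu) - g nu)| < e / 2.
  by move/cvgrPdist_lt: dgl; apply; rewrite divr_gt0.
suff : \forall h \near 0^', `|'D_1 g nu - h^-1 *: (H (h *: 1 + nu) - H nu)| < e by [].
near=> h.
have h0 : h != 0 by near: h; exact: nbhs_dnbhs_neq.
have h1 : `|h| <= 1.
  near: h; apply: dnbhs0_le; exact: ltr01.
have e1 : `|'D_1 g nu - h^-1 *: (g (h *: 1 + nu) - g nu)| < e / 2.
  by near: h; exact: n1.
have := gH h h1; rewrite -[h *: 1]/(h * 1) mulr1 -![_ *: _]/(_ * _) in e1 * => e2.
have e3 : `|h^-1 * (g (h + nu) - g nu) - h^-1 * (H (h + nu) - H nu)| <= e / 2.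
  rewrite -mulrBr normrM normfV ler_pdivrMl ?normr_gt0// mulrC.
  by have -> : g (h + nu) - g nu - (H (h + nu) - H nu) =
    g (h + nu) - H (h + nu) - (g nu - H nu) by ring.
have -> : 'D_1 g nu - h^-1 * (H (h + nu) - H nu) =
  ('D_1 g nu - h^-1 * (g (h + nu) - g nu)) +
  (h^-1 * (g (h + nu) - g nu) - h^-1 * (H (h + nu) - H nu)) by ring.
by rewrite (le_lt_trans (ler_normD _ _))// [ltRHS]splitr ltr_leD.
Unshelve. all: by end_near. Qed.

Lemma derivable_hermite (R : realType) (x nu : R) :
  derivable (fun nu' : R => hermite nu' x) nu 1.
Proof.
apply: derivable_approx => e e0.
have [C hC] := lip_bounded_diff (nu - 1) (nu + 1) `|x|.
have C1 : 0 < `|C| + 1 by rewrite ltr_wpDl.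
have k0 : 0 < 2 * `|x| + 3 by rewrite ltr_wpDl// mulr_ge0.
(* The first bound makes [C d <= e], the second provides the smallness condition of
   [lip_bounded_diff]. *)
have e10 : 0 < Num.min (e / (`|C| + 1)) (2 * `|x| + 3)^-1.
  by rewrite lt_min !divr_gt0 ?invr_gt0.
have [a a0 /(_ a (lexx _))] := charlier_scale_small e10.
rewrite le_min => /andP[d1 d2].
have kd : (2 * `|x| + 3) * (Num.sqrt (2 * a) / a) <= 1.
  by rewrite -ler_pdivlMl// mulr1.
have dx := charlier_degree_ge0 a0 kd (lexx _).
exists (scaled_charlier a x); first exact: derivable_scaled_charlier.
move=> h h1; have [||_ h2] := hC a x a0 kd (lexx _) dx (h + nu) nu.
- by move: h1; rewrite ler_norml => /andP[? ?]; apply/andP; split; lra.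
- by apply/andP; split; lra.
move: h2; rewrite addrK => h2; apply: (le_trans h2); apply: ler_wpM2r => //.
apply: (@le_trans _ _ ((`|C| + 1) * (Num.sqrt (2 * a) / a))).
  apply: ler_wpM2r; first by rewrite divr_ge0 ?sqrtr_ge0// ltW.
  by rewrite (le_trans (ler_norm _))// lerDl.
by rewrite -ler_pdivlMl// [_^-1 * e]mulrC.
Qed.

Lemma derive1_lip_bounded (R : realType) (f g : R -> R) (nu K : R) :
  derivable f nu 1 -> derivable g nu 1 ->
  lip_bounded (nu - 1) (nu + 1) K (fun y => f y - g y) ->
  `|derive1 f nu - derive1 g nu| <= K.
Proof.
move=> df dg hK; have dfg := derivableB df dg.
have -> : derive1 f nu - derive1 g nu = 'D_1 (f - g) nu by rewrite (deriveB df dg) !derive1E.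
have dl : h^-1 *: ((f - g) (h *: 1 + nu) - (f - g) nu) @[h --> 0^'] --> 'D_1 (f - g) nu := dfg.
have nl : `|h^-1 *: ((f - g) (h *: 1 + nu) - (f - g) nu)| @[h --> 0^'] -->
    `|'D_1 (f - g) nu| by apply: cvg_norm.
rewrite -(cvg_lim _ nl)//; apply: (limr_le (cvgP _ nl)); near=> h.
have h0 : h != 0 by near: h; exact: nbhs_dnbhs_neq.
have h1 : `|h| <= 1 by near: h; apply: dnbhs0_le; exact: ltr01.
rewrite -[h *: 1]/(h * 1) mulr1 -[_ *: _]/(_ * _) normrM normfV ler_pdivrMl ?normr_gt0// mulrC.
have [||_] := hK (h + nu) nu.
- by move: h1; rewrite ler_norml => /andP[? ?]; apply/andP; split; lra.
- by apply/andP; split; lra.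
by rewrite addrK.
Unshelve. all: by end_near. Qed.

Lemma derive1_scaled_charlier_hermite_le (R : realType) (nu0 nu1 x0 x1 : R) :
  exists C : R, \forall a \near +oo,
     forall nu x : R, nu \in `[nu0, nu1] -> x \in `[x0, x1] ->
       0 <= charlier_degree a x ->
       `| derive1 (scaled_charlier a x) nu - derive1 (fun nu' : R => hermite nu' x) nu |
         <= C / Num.sqrt a.
Proof.
pose X := `|x0| + `|x1|.
(* The margin 1 leaves room for difference quotients with steps up to 1 in absolute value. *)
have [C hC] := lip_bounded_diff (nu0 - 1) (nu1 + 1) X.
exists (C * Num.sqrt 2).
have k0 : 0 < 2 * X + 3 by rewrite ltr_wpDl// mulr_ge0// addr_ge0.
have [a0 a00 ha0] := charlier_scale_small (ltac:(by rewrite invr_gt0) : 0 < (2 * X + 3)^-1).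
near=> a => nu x; rewrite !in_itv/= => /andP[n0 n1] /andP[xx0 xx1] dx.
have aa0 : a0 <= a by near: a; apply: nbhs_pinfty_ge; exact: num_real.
have a_gt0 : 0 < a by rewrite (lt_le_trans a00).
have kd : (2 * X + 3) * (Num.sqrt (2 * a) / a) <= 1.
  by rewrite -ler_pdivlMl// mulr1 ha0.
have xX : `|x| <= X.
  have := ler_norm x1; have := ler_norm (- x0); rewrite normrN /X => h1 h2.
  have := normr_ge0 x0; have := normr_ge0 x1 => h3 h4.
  by rewrite ler_norml; apply/andP; split; lra.
apply: derive1_lip_bounded.
- exact: derivable_scaled_charlier.
- exact: derivable_hermite.
have [_ _ _ dE] := charlier_scale a_gt0.
rewrite -mulrA -dE; apply: lip_boundedW (hC a x a_gt0 kd xX dx); lra.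
Unshelve. all: by end_near. Qed.

(** * Sharpness *)

(** Two errors of order [d ^ 2]: the quadratic remainder of [exp], and the quartic one of the
    exponent. The 9 is [(2 X + 3) ^ 2] at [X = 0]. *)
Lemma kernel_taylor_le (R : realType) (d s : R) : 0 < d -> 3 * d <= 1 -> 0 < s ->
  `|expR (log_kernel d 0 0 s) - expR (- s ^+ 2) -
    2 / 3 * d * (s ^+ 3 * expR (- s ^+ 2))| <= d ^+ 2 * (800 * expR 9) * expR (- s).
Proof.
move=> d0 kd s0; have s0' := ltW s0.
have n0 : `|0 : R| <= 0 by rewrite normr0.
have t01 : 0 <= (0 : R) <= 1 by rewrite lexx ler01.
have kd' : (2 * 0 + 3) * d <= 1 by rewrite mulr0 add0r.
have e1 : (2 * 0 + 3 : R) ^+ 2 = 9 by rewrite mulr0 add0r; ring.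
have e2 : - s ^+ 2 - 2 * 0 * s = - s ^+ 2 by rewrite mulr0 mul0r subr0.
have h1 := log_kernel_le d0 kd' n0 t01 s0; rewrite e1 in h1.
have h2 : - s ^+ 2 <= 9 - 2 * s by have := sqr_ge0 (s - 1); lra.
have h3 := log_kernel_diff_le d0 n0 t01 s0; rewrite e2 mul0r addr0 in h3.
have h4 := log_kernel_taylor d0 s0.
have h5 := expR_taylor2_le h1 h2.
move: (log_kernel d 0 0 s) h1 h3 h4 h5 => E h1 h3 h4 h5.
have -> : expR E - expR (- s ^+ 2) - 2 / 3 * d * (s ^+ 3 * expR (- s ^+ 2)) =
  (expR E - expR (- s ^+ 2) - expR (- s ^+ 2) * (E - - s ^+ 2)) +
  expR (- s ^+ 2) * (E - - s ^+ 2 - 2 / 3 * d * s ^+ 3) by ring.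
apply: (le_trans (ler_normD _ _)); rewrite [X in _ + X]normrM (ger0_norm (expR_ge0 _)).
have q0 : 0 <= s ^+ 3 + s by rewrite addr_ge0// exprn_ge0.
have h6 : (E - - s ^+ 2) ^+ 2 <= d ^+ 2 * (s ^+ 3 + s) ^+ 2.
  rewrite -exprMn -real_normK ?num_real// ler_pXn2r// nnegrE//.
  by rewrite mulr_ge0// ltW.
have h7 : expR (- s ^+ 2) <= expR (9 - 2 * s) by rewrite ler_expR.
(* The factorial bounds give [720 + 3 * 24 + 2 = 794]. *)
have h8 : (s ^+ 3 + s) ^+ 2 + s ^+ 4 <= 800 * expR s.
  have := expR_pow_le 5 s0'; have := expR_pow_le 3 s0'; have := expR_pow_le 1 s0'.
  have -> : 6`! = 720%N by []. have -> : 4`! = 24%N by []. have -> : 2`! = 2%N by [].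
  have := expR_ge0 s => e0 p1 p2 p3.
  have -> : (s ^+ 3 + s) ^+ 2 + s ^+ 4 = s ^+ 6 + 3 * s ^+ 4 + s ^+ 2 by ring.
  lra.
apply: (@le_trans _ _ (d ^+ 2 * ((s ^+ 3 + s) ^+ 2 + s ^+ 4) * expR (9 - 2 * s))).
  rewrite [leRHS](_ : _ = d ^+ 2 * (s ^+ 3 + s) ^+ 2 * expR (9 - 2 * s) +
    d ^+ 2 * s ^+ 4 * expR (9 - 2 * s)); last by ring.
  apply: lerD.
    by apply: (le_trans h5); rewrite ler_wpM2r ?expR_ge0.
  by rewrite mulrC; apply: ler_pM => //; exact: expR_ge0.
have -> : expR (9 - 2 * s) = expR 9 * (expR (- s) * expR (- s)).
  by rewrite -!expRD; congr expR; ring.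
have -> : d ^+ 2 * (800 * expR 9) * expR (- s) =
    d ^+ 2 * (800 * expR s) * (expR 9 * (expR (- s) * expR (- s))).
  by rewrite expRN; field; exact/lt0r_neq0/expR_gt0.
apply: ler_wpM2r; first by rewrite !mulr_ge0 ?expR_ge0.
by rewrite ler_wpM2l// exprn_ge0// ltW.
Qed.

Lemma charlier_degree_nat (R : realType) (n : nat) :
  `|charlier_degree (n%:R : R) 0|%N = n.
Proof. by rewrite /charlier_degree mul0r subr0 -[n%:R]/((n%:Z)%:~R) intrKceil. Qed.

Lemma euler_integral2 (R : realType) : euler_integral (2 : R) = 1.
Proof.
have [_] := integrable_gammaD1 (@ltr01 R).
by rewrite euler_integral1 mulr1.
Qed.

Lemma euler_integral3 (R : realType) : euler_integral (3 : R) = 2.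
Proof.
have [_] := @integrable_gammaD1 R 2 ltac:(by []).
by rewrite euler_integral2 mulr1 => <-; congr euler_integral; ring.
Qed.

Lemma hermite_N2_0 (R : realType) : hermite (- 2) (0 : R) = 1 / 2.
Proof.
have := hermite_integral (0 : R) (lexx (- 2)).
rewrite opprK euler_integral2 mul1r => ->.
have := @Rint0y_gauss_moment R 2 ltac:(by rewrite ler1n).
rewrite divff// euler_integral1 => <-; apply: Rint0y_eq => s s0.
by rewrite mulr0 mul0r subr0.
Qed.

Lemma scaled_charlier0 (R : realType) (a x : R) : scaled_charlier a x 0 = 1.
Proof.
rewrite /scaled_charlier mul0r powRr0 mul1r charlierE big_ord_recl big1 => [|k _].
  by rewrite /pochhammer big_ord0 bin0 mulr1 divr1 addr0.
by rewrite lift0 pochhammerSl oppr0 mul0r mulr0 mul0r.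
Qed.

(** At [nu = - 3] the first-order term of the kernel contributes [2 / 3 d] times the integral of
    [s ^ 5 exp (- s ^ 2)], which is 1; dividing by [Gamma 3 = 2] gives [d / 3]. *)
Lemma diff_N3_bound (R : realType) :
  exists C : R, forall (n : nat) (a := n.+1%:R) (d := Num.sqrt (2 * a) / a), 3 * d <= 1 ->
    `|scaled_charlier a 0 (- 3) - hermite (- 3) 0 - d / 3| <= C * d ^+ 2.
Proof.
have P2 : 1 <= 2 :> R by rewrite ler1n.
have [C C0 hC] := lip_bounded_moment P2.
exists (C * (800 * expR 9)) => n a d kd.
have a0 : 0 < a by [].
have [d0 _ _ _] := charlier_scale a0; rewrite -/d in d0.
have [||_ h] := hC (d ^+ 2 * (800 * expR 9)) (fun s => expR (log_kernel d 0 0 s)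
  - expR (- s ^+ 2) - 2 / 3 * d * (s ^+ 3 * expR (- s ^+ 2))).
- move=> t t0; apply: cvgB.
    apply: cvgB; last exact: continuous_gauss_fun.
    exact: (cvg_comp _ _ (continuous_log_kernel d0 t0) (@continuous_expR _ _)).
  apply: cvgM; first exact: cvg_cst.
  by apply: cvgM; [exact: exprn_continuous|exact: continuous_gauss_fun].
- by move=> s s0; exact: kernel_taylor_le.
have i2 : 1 <= (2 : R) <= 2 by rewrite P2 lexx.
have [b _] := h 2 2 i2 i2.
have nu0 : - 3 < 0 :> R by rewrite oppr_lt0.
have [j1 v1] := scaled_charlier_integral 0 a0 nu0.
have j2 := @integrable_gauss_shift R (- - 3 - 1) 0 ltac:(lra).
have v2 := @hermite_integral R (- 3) 0 ltac:(lra).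
have j3 := @integrable_gauss_moment R 5 ltac:(by []).
have v3 := @Rint0y_gauss_moment R 6 ltac:(by rewrite ler1n).
have [j4 v4] := Rint0yZ (2 / 3 * d) j3.
have [j5 v5] := Rint0yB j1 j2.
have [j6 v6] := Rint0yB j5 j4.
have E6 : 6 / 2 = 3 :> R by field.
have E5 : (6 - 1 : R) = 5 by ring.
rewrite E6 E5 euler_integral3 divff// in v3.
rewrite v5 v4 v3 -v1 -v2 opprK euler_integral3 mulr1 in v6.
have E : Rint0y (fun s => s `^ 2 * (expR (log_kernel d 0 0 s)
    - expR (- s ^+ 2) - 2 / 3 * d * (s ^+ 3 * expR (- s ^+ 2)))) =
  2 * (scaled_charlier a 0 (- 3) - hermite (- 3) 0 - d / 3).
  rewrite [RHS](_ : _ = 2 * scaled_charlier a 0 (- 3) - 2 * hermite (- 3) 0 - 2 / 3 * d);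
    last by field.
  rewrite -v6; apply: Rint0y_eq => s s0.
  rewrite (scaled_charlier_kernel 0 a0 s0) charlier_degree_nat mul0r subr0 subrr -/d.
  rewrite mulr0 mul0r subr0.
  have -> : 3 - 1 = 2 :> R by ring.
  have -> : s `^ 5 = s `^ 2 * s ^+ 3.
    rewrite -(@powR_mulrn _ s 3) ?(ltW s0)// -powRD ?(gt_eqF s0) ?implybT//.
    by congr (_ `^ _); ring.
  ring.
rewrite E normrM normr_nat in b.
have c0 : 0 <= `|scaled_charlier a 0 (- 3) - hermite (- 3) 0 - d / 3| by [].
have -> : C * (800 * expR 9) * d ^+ 2 = C * (d ^+ 2 * (800 * expR 9)) by ring.
by apply: le_trans b; rewrite ler_peMl// ler1n.
Qed.

(** For [x = 0] and integer [a], both recurrences read at [z - 1] have the factor [z - 1] on the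
    right, so the derivatives at 1 are plain values of the cofactors. *)
Lemma derive1_mul_root (R : realType) (f g : R -> R) (y : R) :
  (forall z, f z = (z - y) * g z) -> derivable g y 1 -> derive1 f y = g y.
Proof.
move=> fE dg; have -> : f = (fun z => z - y) * g by apply/funext => z; rewrite fE fctE.
have dl : is_derive y 1 (fun z : R => z - y) 1 by apply: is_derive_eq; rewrite subr0.
have := is_deriveM dl (derivableP dg) => h.
rewrite derive1E (derive_val (is_derive := h)).
by rewrite subrr scale0r add0r /GRing.scale/= mulr1.
Qed.

Lemma derivable_shift (R : realType) (f : R -> R) (r y : R) : derivable f (y - r) 1 ->
  derivable (fun z => f (z - r)) y 1.
Proof.
move=> df; have dl : is_derive y 1 (fun z : R => z - r) 1.
  by apply: is_derive_eq; rewrite subr0.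
have := @is_derive1_comp _ f (fun z => z - r) y _ _ (derivableP df) dl.
by move=> [].
Qed.

Lemma derive1_scaled_charlier_1 (R : realType) (n : nat) (a := n.+1%:R : R) :
  derive1 (scaled_charlier a 0) 1 =
  Num.sqrt (2 * a) / a - 2 * scaled_charlier a 0 (- 1).
Proof.
have a0 : 0 < a by [].
set d := Num.sqrt (2 * a) / a.
pose g z := d * scaled_charlier a 0 (z - 1) - 2 * scaled_charlier a 0 (z - 2).
have dg : derivable g 1 1.
  apply: derivableB; apply: derivableM => //; apply: derivable_shift;
    exact: derivable_scaled_charlier.
rewrite (@derive1_mul_root _ _ g 1) => [|z|]; last exact: dg.
  rewrite /g subrr scaled_charlier0 mulr1; congr (_ - _ * scaled_charlier _ _ _); ring.
have := scaled_charlier_recurrence 0 (z - 1) a0.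
rewrite charlier_degree_nat subrK addrK -/d /g => ->.
have -> : z - 1 - 1 = z - 2 by ring.
ring.
Qed.

Lemma derive1_hermite_1 (R : realType) :
  derive1 (fun nu' => hermite nu' (0 : R)) 1 = - 2 * hermite (- 1) 0.
Proof.
pose g z := - 2 * hermite (z - 2) (0 : R).
have dg : derivable g 1 1.
  apply: derivableM => //; apply: (@derivable_shift _ (fun z => hermite z 0)).
  exact: derivable_hermite.
rewrite (@derive1_mul_root _ _ g 1) => [|z|]; last exact: dg.
  by rewrite /g; congr (_ * hermite _ _); ring.
have := hermite_recurrence (z - 1) (0 : R).
rewrite subrK /g => ->.
have -> : z - 1 - 1 = z - 2 by ring.
ring.
Qed.

Lemma derive1_diff_asymptotics (R : realType) :
  exists C : R, forall (n : nat) (a := n.+1%:R) (d := Num.sqrt (2 * a) / a), 3 * d <= 1 ->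
    `|Num.sqrt a * (derive1 (scaled_charlier a 0) 1 -
        derive1 (fun nu' => hermite nu' 0) 1) - Num.sqrt 2 / 3| <= C * d.
Proof.
have [C1 h1] := diff_N3_bound R.
(* A one-point interval: only the size of [f (- 2) - 1 / 2] is wanted. *)
have [C2 h2] := @lip_bounded_diff R (- 2) (- 2) 0.
exists (4 * Num.sqrt 2 * C2 + 8 * (Num.sqrt 2 * C1)) => n a d kd.
have a0 : 0 < a by [].
have [d0 _ _ dE] := charlier_scale a0; rewrite -/d in d0 dE.
have b1 := h1 n kd.
have kd' : (2 * 0 + 3) * d <= 1 by rewrite mulr0 add0r.
have n0 : `|0 : R| <= 0 by rewrite normr0.
have dx : 0 <= charlier_degree a 0 := charlier_degree_ge0 a0 kd' n0.
have N2 : - 2 <= (- 2 : R) <= - 2 by rewrite lexx.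
have [b2 _] := h2 a 0 a0 kd' n0 dx _ _ N2 N2.
have s0 : 0 < Num.sqrt a by rewrite sqrtr_gt0.
have sd : Num.sqrt a * d = Num.sqrt 2 by rewrite dE mulrCA divff ?mulr1// gt_eqF.
have r1 := scaled_charlier_recurrence 0 (- 2) a0.
have r2 := hermite_recurrence (- 2) (0 : R).
rewrite charlier_degree_nat addrK -/d in r1.
have e1 : - 2 + 1 = - 1 :> R by ring.
have e2 : - 2 - 1 = - 3 :> R by ring.
rewrite e1 e2 in r1 r2.
rewrite derive1_scaled_charlier_1 derive1_hermite_1 -/a -/d r1 r2.
rewrite hermite_N2_0 -/a -/d in b2; rewrite -/a -/d in b1.
have sq2 : 0 <= Num.sqrt 2 :> R by exact: sqrtr_ge0.
move: (scaled_charlier a 0 (- 3)) (scaled_charlier a 0 (- 2)) (hermite (- 3) 0)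
  (hermite (- 2) 0) (Num.sqrt a) s0 sd b1 b2 => f3 f2 H3 H2 s s0 sd b1 b2.
move: (Num.sqrt 2) sq2 sd => q q0 sd.
(* To first order [d + 4 d f (- 2) - 8 (f (- 3) - H (- 3))] is [d + 2 d - 8 d / 3 = d / 3], and
   [sqrt a * d = sqrt 2]. *)
have -> : s * (d - 2 * (d * -2 * f2 - 2 * -2 * f3) - -2 * (2 * 0 * H2 - 2 * -2 * H3)) - q / 3 =
  4 * (s * d) * (f2 - 1 / 2) - 8 * (s * (f3 - H3 - d / 3)) by rewrite -sd; field.
rewrite sd; apply: (le_trans (ler_normB _ _)); rewrite [leRHS]mulrDl; apply: lerD.
  by rewrite normrM ger0_norm ?mulr_ge0// -[leRHS]mulrA ler_wpM2l// mulr_ge0.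
rewrite normrM normr_nat -[leRHS]mulrA ler_wpM2l// normrM (gtr0_norm s0).
apply: (le_trans (ler_wpM2l (ltW s0) b1)).
by rewrite -sd le_eqVlt; apply/orP; left; apply/eqP; ring.
Qed.

Lemma derive1_diff_sharp (R : realType) :
  exists nu x K : R, K != 0 /\
     exists a : nat -> R, a @ \oo --> +oo /\
       (fun k : nat => Num.sqrt (a k) *
          (derive1 (scaled_charlier (a k) x) nu
           - derive1 (fun nu' : R => hermite nu' x) nu)) @ \oo --> K.
Proof.
exists 1, 0, (Num.sqrt 2 / 3); split.
  by rewrite lt0r_neq0// divr_gt0// sqrtr_gt0.
have [_ _ _ vc] := harmonic_exhaust R.
exists (fun n => n.+1%:R); split=> //.
have [C hC] := derive1_diff_asymptotics R.
apply/cvgrPdist_le => e e0.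
have C1 : 0 < `|C| + 1 by rewrite ltr_wpDl.
have e10 : 0 < Num.min (e / (`|C| + 1)) 3^-1 by rewrite lt_min divr_gt0//= invr_gt0.
have [a0 a00 ha0] := charlier_scale_small e10.
near=> n.
have an : a0 <= n.+1%:R by near: n; move/cvgryPge: vc; exact.
have := ha0 _ an; rewrite le_min => /andP[d1 d2].
have kd : 3 * (Num.sqrt (2 * n.+1%:R) / n.+1%:R) <= 1 :> R.
  by rewrite -ler_pdivlMl// mulr1.
rewrite distrC; apply: (le_trans (hC n kd)).
apply: (@le_trans _ _ ((`|C| + 1) * (Num.sqrt (2 * n.+1%:R) / n.+1%:R))).
  apply: ler_wpM2r; first by rewrite divr_ge0 ?sqrtr_ge0.
  by rewrite (le_trans (ler_norm _))// lerDl.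
by rewrite -ler_pdivlMl// [_^-1 * e]mulrC.
Unshelve. all: by end_near. Qed.

Theorem theorem4 (R : realType) :
  (* both partial derivatives in nu exist *)
  (forall a x nu : R, 0 < a -> 0 <= charlier_degree a x ->
     derivable (scaled_charlier a x) nu 1) /\
  (forall x nu : R, derivable (fun nu' : R => hermite nu' x) nu 1) /\
  (* their difference is O(1/sqrt a), uniformly on bounded intervals *)
  (forall nu0 nu1 x0 x1 : R, exists C : R, \forall a \near +oo,
     forall nu x : R, nu \in `[nu0, nu1] -> x \in `[x0, x1] ->
       0 <= charlier_degree a x ->
       `| derive1 (scaled_charlier a x) nu - derive1 (fun nu' : R => hermite nu' x) nu |
         <= C / Num.sqrt a) /\
  (* sharpness: the error behaves like K / sqrt a along arbitrarily large a *)
  (exists nu x K : R, K != 0 /\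
     exists a : nat -> R, a @ \oo --> +oo /\
       (fun k : nat => Num.sqrt (a k) *
          (derive1 (scaled_charlier (a k) x) nu
           - derive1 (fun nu' : R => hermite nu' x) nu)) @ \oo --> K).
Proof.
split; first by move=> a x nu a0 _; exact: derivable_scaled_charlier.
split; first by move=> x nu; exact: derivable_hermite.
split; first exact: derive1_scaled_charlier_hermite_le.
exact: derive1_diff_sharp.
Qed.
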